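(* Let $h:\mathbb{R}\to\mathbb{C}$ be continuous with compact support. Let $\lambda,\epsilon\in\mathbb{R}$, $\ell=-\frac12+i\lambda$, and for $x\ge 1$ put $$h_x=\frac{\sqrt2}{x^{1+2i\lambda}}\sum_{m\in\epsilon+\mathbb{Z}}e^{i\pi m}\,h\Bigl(\frac{2m}{x^2}\Bigr)\,\mathbf{e}_m .$$ Then for every $g\in L^2(\mathbb{R})$, $$\bigl(A_x g\mid h_x\bigr)\ \to\ (\hat g\mid h)\qquad\text{for } x\to\infty .$$
   Context: $(f\mid g)=\int_{\mathbb{R}} f\,\overline{g}\,dt$ is the inner product of $L^2(\mathbb{R})$. For $\ell=-\frac12+i\lambda$ and $m\in\mathbb{R}$, $\mathbf{e}_m\in L^2(\mathbb{R})$ is $\mathbf{e}_m(t)=\frac{1}{\sqrt{\pi}}\,e^{-i\pi m}\,e^{2im\arctan t}\,(t^2+1)^{\ell}$; for each $\epsilon\in\mathbb{R}$, $(\mathbf{e}_m)_{m\in\epsilon+\mathbb{Z}}$ is an orthonormal basis of $L^2(\mathbb{R})$. For $x>0$, $A_x$ is the unitary operator on $L^2(\mathbb{R})$ given by $(A_xf)(t)=x^{-2\ell}f(x^2t)$. (It is the operator $T_\chi(\mathrm{diag}(x,\frac1x))$ of the principal series representation $T_\chi$, $\chi=(\ell,\epsilon)$, of the universal covering group of $SL(2,\mathbb{R})$; $\mathbf{e}_m$, $m\in\epsilon+\mathbb{Z}$, is the paper's basis vector $e^\chi_{m-\epsilon}$.) The Fourier transform is $\hat f(y)=\frac1{\sqrt{2\pi}}\int_{\mathbb{R}}e^{-ity}f(t)\,dt$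 for $f\in L^1(\mathbb{R})$, extended to $L^2(\mathbb{R})$ as a unitary operator (Plancherel). *)

(* Defs.v *)
From HB Require Import structures.
From mathcomp Require Import all_boot all_order all_algebra.
From mathcomp Require Import all_classical all_reals all_analysis.
From mathcomp Require Export complex.

Set Implicit Arguments.
Unset Strict Implicit.
Unset Printing Implicit Defensive.

Import Order.TTheory GRing.Theory Num.Theory.
Import numFieldNormedType.Exports.

Local Open Scope classical_set_scope.
Local Open Scope ring_scope.
Local Open Scope complex_scope.

(* The MathComp-Analysis library has no complex-valued measure theory:
   measurability and integrals of functions with values in [R[i]] are taken
   on real and imaginary parts. Elements of L^2(R) are represented by
   functions, not by classes modulo equality almost everywhere. *)

Section ComplexIntegration.
Context {R : realType}.
Implicit Types f g : R -> R[i].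

Local Notation mu := (@lebesgue_measure R).

Definition cmeasurable f :=
  measurable_fun [set: R] (fun t => complex.Re (f t)) /\
  measurable_fun [set: R] (fun t => complex.Im (f t)).

Definition cintegral f : R[i] :=
  Rintegral mu [set: R] (fun t => complex.Re (f t)) +i*
  Rintegral mu [set: R] (fun t => complex.Im (f t)).

Definition cLnorm (p : R) f : \bar R :=
  Lnorm mu p%:E (fun t => (Normc.normc (f t))%:E).

Definition inL1 f := cmeasurable f /\ (cLnorm 1 f < +oo)%E.

Definition inL2 f := cmeasurable f /\ (cLnorm 2 f < +oo)%E.

Definition inner f g : R[i] := cintegral (fun t => f t * (g t)^*%C).

End ComplexIntegration.

Section ComplexPowers.
Context {R : realType}.

Definition cexp (z : R[i]) : R[i] :=
  (expR (complex.Re z))%:C * (cos (complex.Im z) +i* sin (complex.Im z)).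

(* a ^ z, meaningful for a > 0. *)
Definition cpow (a : R) (z : R[i]) : R[i] := cexp (z * (ln a)%:C).

End ComplexPowers.

Section Fourier.
Context {R : realType}.
Implicit Types f g : R -> R[i].

Definition fourierL1 f (y : R) : R[i] :=
  ((Num.sqrt (2 * pi))^-1)%:C * cintegral (fun t => cexp (0 -i* (t * y)) * f t).

(* [ghat] is a value at [g] of the extension of the Fourier transform by
   continuity from L^1 \cap L^2 to L^2. As L^1 \cap L^2 is dense in L^2, this
   determines [ghat] almost everywhere. *)
Definition is_fourierL2 g ghat :=
  inL2 ghat /\
  forall f_ : nat -> R -> R[i],
    (forall n, inL1 (f_ n) /\ inL2 (f_ n)) ->
    cLnorm 2 (fun t => f_ n t - g t) @[n --> \oo] --> 0%E ->
    cLnorm 2 (fun y => fourierL1 (f_ n) y - ghat y) @[n --> \oo] --> 0%E.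

(* By Plancherel's theorem the set below is nonempty whenever [g] is in L^2,
   so that the default value is then irrelevant. *)
Definition fourierL2 g : R -> R[i] :=
  xget (fun=> 0) [set ghat | is_fourierL2 g ghat].

End Fourier.

Section PrincipalSeries.
Context {R : realType}.

Definition ell (lambda : R) : R[i] := (- 2^-1) +i* lambda.

Definition basis_e (lambda m : R) (t : R) : R[i] :=
  ((Num.sqrt pi)^-1)%:C * cexp (0 -i* (pi * m)) *
  cexp (0 +i* (2 * m * atan t)) * cpow (t ^+ 2 + 1) (ell lambda).

Definition dilation (lambda x : R) (f : R -> R[i]) (t : R) : R[i] :=
  cpow x (- 2 * ell lambda) * f (x ^+ 2 * t).

(* The sum over m = epsilon + k, k an integer, is taken pointwise as a sum of
   finite support: only finitely many m have h (2 m / x^2) <> 0 when [h] has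
   compact support and x > 0. *)
Definition h_ (lambda epsilon : R) (h : R -> R[i]) (x t : R) : R[i] :=
  (Num.sqrt 2)%:C / cpow x (1 +i* (2 * lambda)) *
  \sum_(k \in [set: int])
    let m := epsilon + k%:~R in
    cexp (0 +i* (pi * m)) * h (2 * m / x ^+ 2) * basis_e lambda m t.

End PrincipalSeries.

(* Main.v *)
(* In the coordinate s = x^2 t the number (A_x g | h_x) becomes (g | S_N), N = x^2, where
   S_N(s) is the Riemann sum, over the points y = 2m/N, of
   (2 pi)^(-1/2) h(y) exp(i y N atan(s/N)) (1 + s^2/N^2)^ell.
   For g in L^1 the sum and the integral over s can be exchanged, and dominated
   convergence, first in s and then in y, gives (g | S_N) -> (ghat | h). Orthogonality of
   the e_m turns |S_N|^2 into a Riemann sum of |h|^2, so that |S_N| -> |h| in L^2 norm,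
   and the result extends from L^1 \cap L^2 to L^2 by density.
   The same two limits prove the part of Plancherel's theorem that is needed: for f in
   L^1 \cap L^2 they give |(fhat | h)| <= |f| |h| for all continuous h with compact
   support, hence |fhat| <= |f|; the transform of a function of L^2 is then the limit
   almost everywhere of the transforms of truncations converging fast enough. *)
Require Import Defs.
From mathcomp Require Import all_boot all_order all_algebra.
From mathcomp Require Import all_classical all_reals all_analysis.
From mathcomp Require Import measurable_realfun ring lra zify.
Import Order.TTheory GRing.Theory Num.Theory.
Import numFieldNormedType.Exports.
Local Open Scope classical_set_scope.
Local Open Scope ring_scope.
Local Open Scope complex_scope.

Set Implicit Arguments.
Unset Strict Implicit.
Unset Printing Implicit Defensive.

(** The obstacle is that the summands of S_N have no limit in L^2: in the coordinate s each wave
    converges pointwise to exp(i y s), while its squared norm N pi tends to infinity. So for a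
    general g nothing can be done term by term, and what carries the argument is the bound on |S_N|.
    That bound rests on the waves at the nodes being exactly orthogonal for every N: their squared
    modulus is N times the derivative of atan(s/N) and does not depend on y, so the substitution
    theta = atan(s/N) turns their inner products into integrals of exp(2 i (k - l) theta) over an
    interval of length pi. The constants fit: the squared coefficient (2/N)^2 / (2 pi) times the
    squared norm N pi is the mesh 2/N again. Since [fourierL2] picks an element of a set, nothing is
    known of it until that set is shown to be inhabited; this is why a part of Plancherel's theorem
    enters. Norms are handled through their squares, with weighted forms of 2ab <= a^2 + b^2 in the
    place of the Cauchy-Schwarz and triangle inequalities. *)

Local Notation cRe := complex.Re.
Local Notation cIm := complex.Im.

(** * Complex numbers and complex-valued integrals *)

Section ComplexNorm.
Context {R : realType}.
Implicit Types z w : R[i].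
Import Normc.

Lemma sqr_normcE z : normc z ^+ 2 = complex.Re z ^+ 2 + complex.Im z ^+ 2.
Proof. by case: z => a b /=; rewrite sqr_sqrtr// addr_ge0// sqr_ge0. Qed.

Lemma normc_ge0 z : 0 <= normc z.
Proof. by case: z => a b; exact: sqrtr_ge0. Qed.

Lemma normc_norm z : `|z| = (normc z)%:C.
Proof. by []. Qed.

Lemma normc_geRe z : `|complex.Re z| <= normc z.
Proof.
by rewrite -ler_sqr ?nnegrE ?normc_ge0// sqr_normcE real_normK ?num_real// lerDl sqr_ge0.
Qed.

Lemma normc_geIm z : `|complex.Im z| <= normc z.
Proof.
by rewrite -ler_sqr ?nnegrE ?normc_ge0// sqr_normcE real_normK ?num_real// lerDr sqr_ge0.
Qed.

Lemma normc_leD z : normc z <= `|complex.Re z| + `|complex.Im z|.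
Proof.
rewrite -ler_sqr ?nnegrE ?normc_ge0 ?addr_ge0// sqr_normcE sqrrD !real_normK ?num_real//.
by rewrite -addrA lerD2l lerDr mulrn_wge0// mulr_ge0.
Qed.

Lemma normc_real (a : R) : normc a%:C = `|a|.
Proof. by rewrite /= expr0n/= addr0 sqrtr_sqr. Qed.

Lemma normc_conj z : normc (z^*)%C = normc z.
Proof. by case: z => a b /=; rewrite sqrrN. Qed.

Lemma conjcM z w : ((z * w)^*)%C = (z^*)%C * (w^*)%C.
Proof. exact: rmorphM. Qed.

Lemma conjc_sum (I : Type) (s : seq I) (F : I -> R[i]) :
  ((\sum_(i <- s) F i)^*)%C = \sum_(i <- s) ((F i)^*)%C.
Proof. exact: raddf_sum. Qed.

Lemma mulcJ z : z * (z^*)%C = (normc z ^+ 2)%:C.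
Proof. by rewrite sqr_normcE; case: z => a b; simpc; congr (_ +i* _); ring. Qed.

Lemma ReD z w : complex.Re (z + w) = complex.Re z + complex.Re w.
Proof. by case: z => ? ?; case: w. Qed.
Lemma ImD z w : complex.Im (z + w) = complex.Im z + complex.Im w.
Proof. by case: z => ? ?; case: w. Qed.
Lemma ReB z w : complex.Re (z - w) = complex.Re z - complex.Re w.
Proof. by case: z => ? ?; case: w. Qed.
Lemma ImB z w : complex.Im (z - w) = complex.Im z - complex.Im w.
Proof. by case: z => ? ?; case: w. Qed.
Lemma ReM z w : complex.Re (z * w) = complex.Re z * complex.Re w - complex.Im z * complex.Im w.
Proof. by case: z => ? ?; case: w. Qed.
Lemma ImM z w : complex.Im (z * w) = complex.Re z * complex.Im w + complex.Im z * complex.Re w.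
Proof. by case: z => ? ?; case: w. Qed.

Lemma cvg_normcP (T : Type) (F : set_system T) {FF : Filter F}
    (u : T -> R[i]^o) (l : R[i]^o) :
  u @ F --> l <-> normc (u t - l) @[t --> F] --> (0 : R).
Proof.
split.
- move=> /cvgrPdist_lt ul; apply/cvgrPdist_lt => e e0.
  have e0' : 0 < e%:C by rewrite ltcR.
  near=> t; have : `|l - u t| < e%:C by near: t; exact: ul.
  by rewrite sub0r normrN (ger0_norm (normc_ge0 _)) -[u t - l]opprB normcN normc_norm ltcR.
- move=> /cvgrPdist_lt ul; apply/cvgrPdist_lt => -[e e'].
  (* In the order of [R[i]] a positive number is real, so balls of complex radius are balls of real
     radius. *)
  rewrite ltcE/= => /andP[/eqP -> e0].
  near=> t; have : `|0 - normc (u t - l)| < e by near: t; exact: ul.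
  by rewrite sub0r normrN (ger0_norm (normc_ge0 _)) -[u t - l]opprB normcN normc_norm ltcR.
Unshelve. all: by end_near. Qed.

Lemma cvg_complexP (T : Type) (F : set_system T) {FF : Filter F}
    (u : T -> R[i]^o) (l : R[i]^o) :
  u @ F --> l <-> (complex.Re (u t) @[t --> F] --> complex.Re l) /\
                 (complex.Im (u t) @[t --> F] --> complex.Im l).
Proof.
rewrite cvg_normcP; split.
- move=> /cvgrPdist_lt ul; split; apply/cvgrPdist_lt => e e0; near=> t;
  have : `|0 - normc (u t - l)| < e by near: t; exact: ul.
  + rewrite sub0r normrN ger0_norm ?normc_ge0//; apply: le_lt_trans.
    by rewrite distrC -ReB normc_geRe.
  + rewrite sub0r normrN ger0_norm ?normc_ge0//; apply: le_lt_trans.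
    by rewrite distrC -ImB normc_geIm.
- move=> [/cvgrPdist_lt ul /cvgrPdist_lt vl]; apply/cvgrPdist_lt => e e0; near=> t.
  have h1 : `|complex.Re l - complex.Re (u t)| < e / 2.
    by near: t; apply: ul; rewrite divr_gt0.
  have h2 : `|complex.Im l - complex.Im (u t)| < e / 2.
    by near: t; apply: vl; rewrite divr_gt0.
  rewrite sub0r normrN ger0_norm ?normc_ge0// (le_lt_trans (normc_leD _))//.
  by rewrite ReB ImB [e]splitr ltrD// distrC.
Unshelve. all: by end_near. Qed.

Lemma cvg_conjc (T : Type) (F : set_system T) {FF : Filter F}
    (u : T -> R[i]^o) (l : R[i]^o) :
  u @ F --> l -> ((u t)^*%C : R[i]^o) @[t --> F] --> (l^*%C : R[i]^o).
Proof.
rewrite !cvg_normcP; apply: cvg_trans; apply: near_eq_cvg; apply: nearW => t.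
by rewrite -raddfB normc_conj.
Qed.

Lemma cvg_normc (T : Type) (F : set_system T) {FF : Filter F}
    (u : T -> R[i]^o) (l : R[i]^o) :
  u @ F --> l -> normc (u t) @[t --> F] --> normc l.
Proof.
move=> /cvg_normcP ul; apply/cvgrPdist_le => e e0.
move/cvgrPdist_le : ul => /(_ e e0); apply: filterS => t.
rewrite sub0r normrN (ger0_norm (normc_ge0 _)); apply: le_trans.
have h1 := le_normcD (u t - l) l; have h2 := le_normcD (l - u t) (u t).
rewrite !subrK in h1 h2; rewrite -[l - _]opprB normcN in h2.
by rewrite ler_distlC; apply/andP; split; lra.
Qed.

End ComplexNorm.

(** * Complex integrals: linearity, bounds, dominated convergence *)

Section CIntegral.
Context {R : realType}.
Implicit Types f g : R -> R[i].
Import Normc.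
Local Notation mu := (@lebesgue_measure R).

Lemma cmeasurableD f g : cmeasurable f -> cmeasurable g -> cmeasurable (fun t => f t + g t).
Proof.
move=> [f1 f2] [g1 g2]; split.
  by under eq_fun do rewrite ReD; exact: measurable_funD.
by under eq_fun do rewrite ImD; exact: measurable_funD.
Qed.

Lemma cmeasurableB f g : cmeasurable f -> cmeasurable g -> cmeasurable (fun t => f t - g t).
Proof.
move=> [f1 f2] [g1 g2]; split.
  by under eq_fun do rewrite ReB; exact: measurable_funB.
by under eq_fun do rewrite ImB; exact: measurable_funB.
Qed.

Lemma cmeasurableM f g : cmeasurable f -> cmeasurable g -> cmeasurable (fun t => f t * g t).
Proof.
move=> [f1 f2] [g1 g2]; split.
  by under eq_fun do rewrite ReM; apply: measurable_funB; exact: measurable_funM.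
by under eq_fun do rewrite ImM; apply: measurable_funD; exact: measurable_funM.
Qed.

Lemma cmeasurable_conj f : cmeasurable f -> cmeasurable (fun t => (f t)^*%C).
Proof.
move=> [f1 f2]; split.
  by rewrite (_ : (fun _ => _) = (fun t => cRe (f t)))//; apply/funext => t; case: (f t).
rewrite (_ : (fun _ => _) = (fun t => - cIm (f t)))//; last first.
  by apply/funext => t; case: (f t).
exact: measurableT_comp.
Qed.

Lemma cmeasurable_cst (z : R[i]) : cmeasurable (fun=> z).
Proof. by split; exact: measurable_cst. Qed.

Lemma measurable_normc f : cmeasurable f -> measurable_fun setT (fun t => normc (f t)).
Proof.
move=> [f1 f2].
rewrite (_ : (fun _ => _) =
    (fun t => Num.sqrt (cRe (f t) ^+ 2 + cIm (f t) ^+ 2)))//; last first.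
  by apply/funext => t; case: (f t).
apply: (measurableT_comp (f := @Num.sqrt R)).
  exact: (continuous_measurable_fun (@sqrt_continuous R)).
by apply: measurable_funD; exact: measurable_funX.
Qed.

Definition cintegrable f :=
  mu.-integrable setT (EFin \o (fun t => cRe (f t))) /\
  mu.-integrable setT (EFin \o (fun t => cIm (f t))).

Lemma cintegrable_le f (G : R -> R) : cmeasurable f -> mu.-integrable setT (EFin \o G) ->
  (forall t, normc (f t) <= G t) -> cintegrable f.
Proof.
move=> [f1 f2] iG fG.
have G0 t : 0 <= G t by rewrite (le_trans (normc_ge0 _) (fG t)).
split; apply: le_integrable iG => //=.
- exact/measurable_EFinP.
- by move=> t _; rewrite lee_fin (ger0_norm (G0 t)) (le_trans _ (fG t))// normc_geRe.
- exact/measurable_EFinP.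
- by move=> t _; rewrite lee_fin (ger0_norm (G0 t)) (le_trans _ (fG t))// normc_geIm.
Qed.

Lemma cintegrable_meas f : cintegrable f -> cmeasurable f.
Proof.
by move=> [/integrableP[/measurable_EFinP ? _] /integrableP[/measurable_EFinP ? _]].
Qed.

Lemma cintegrable_normc f : cintegrable f ->
  mu.-integrable setT (EFin \o (fun t => normc (f t))).
Proof.
move=> cf; have mf := measurable_normc (cintegrable_meas cf); case: cf => f1 f2.
have := integrableD measurableT (integrable_abse f1) (integrable_abse f2).
apply: le_integrable => //=; first exact/measurable_EFinP.
move=> t _; rewrite lee_fin (ger0_norm (normc_ge0 _)) ger0_norm ?addr_ge0//.
exact: normc_leD.
Qed.

Lemma cintegrableD f g : cintegrable f -> cintegrable g -> cintegrable (fun t => f t + g t).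
Proof.
move=> [f1 f2] [g1 g2]; split.
- rewrite (_ : EFin \o _ = (EFin \o (fun t => cRe (f t))) \+ (EFin \o (fun t => cRe (g t)))).
    exact: integrableD.
  by apply/funext => t /=; rewrite ReD EFinD.
- rewrite (_ : EFin \o _ = (EFin \o (fun t => cIm (f t))) \+ (EFin \o (fun t => cIm (g t)))).
    exact: integrableD.
  by apply/funext => t /=; rewrite ImD EFinD.
Qed.

Lemma cintegralD f g : cintegrable f -> cintegrable g ->
  cintegral (fun t => f t + g t) = cintegral f + cintegral g.
Proof.
move=> [f1 f2] [g1 g2]; rewrite /cintegral.
under eq_Rintegral do rewrite ReD.
under [X in _ +i* X]eq_Rintegral do rewrite ImD.
by rewrite !RintegralD//.
Qed.

Lemma cintegrableZ (z : R[i]) f : cintegrable f -> cintegrable (fun t => z * f t).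
Proof.
move=> cf; have mf := cintegrable_meas cf; have := cintegrable_normc cf => nf.
apply: (@cintegrable_le _ (fun t => normc z * normc (f t))).
- exact: cmeasurableM (cmeasurable_cst z) mf.
- exact: (integrableZl measurableT _ nf).
- by move=> t; rewrite normcM.
Qed.

Lemma cintegralZ (z : R[i]) f : cintegrable f ->
  cintegral (fun t => z * f t) = z * cintegral f.
Proof.
move=> [f1 f2]; rewrite /cintegral.
under eq_Rintegral do rewrite ReM.
under [X in _ +i* X]eq_Rintegral do rewrite ImM.
have h r (u : R -> R) : mu.-integrable setT (EFin \o u) ->
   mu.-integrable setT (EFin \o (fun t => r * u t)).
  by move=> iu; exact: (integrableZl measurableT _ iu).
rewrite RintegralB ?RintegralD ?RintegralZl//; try exact: h.
by case: z => a b; simpc.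
Qed.

Lemma cintegrable0 : cintegrable (fun=> 0).
Proof.
by split => /=; rewrite (_ : EFin \o _ = cst 0%E)//; exact: integrable0.
Qed.

Lemma cintegral0 : cintegral (fun=> 0 : R[i]) = 0 :> R[i].
Proof. by rewrite /cintegral /= !Rintegral_cst//= !mul0r. Qed.

Lemma cintegrable_sum (I : Type) (s : seq I) (F : I -> R -> R[i]) :
  (forall i, cintegrable (F i)) -> cintegrable (fun t => \sum_(i <- s) F i t).
Proof.
move=> iF; elim: s => [|a s ih].
  by under eq_fun do rewrite big_nil; exact: cintegrable0.
by under eq_fun do rewrite big_cons; exact: cintegrableD.
Qed.

Lemma cintegral_sum (I : Type) (s : seq I) (F : I -> R -> R[i]) :
  (forall i, cintegrable (F i)) ->
  cintegral (fun t => \sum_(i <- s) F i t) = \sum_(i <- s) cintegral (F i).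
Proof.
move=> iF; elim: s => [|a s ih].
  by under eq_fun do rewrite big_nil; rewrite big_nil cintegral0.
under eq_fun do rewrite big_cons.
by rewrite big_cons cintegralD// ?ih//; exact: cintegrable_sum.
Qed.

(** The factor 2 comes from bounding the real and the imaginary part separately by the same G. *)
Lemma le_normc_cintegral f (G : R -> R) : cmeasurable f -> mu.-integrable setT (EFin \o G) ->
  (forall t, normc (f t) <= G t) -> normc (cintegral f) <= 2 * \int[mu]_t G t.
Proof.
move=> mf iG fG; have [f1 f2] := cintegrable_le mf iG fG.
rewrite (le_trans (normc_leD _))// mulr_natl mulr2n lerD//=.
- apply: le_trans (le_normr_Rintegral _ f1) _ => //; apply: le_Rintegral => //.
    exact: integrable_norm.
  by move=> t _; rewrite (le_trans _ (fG t))// normc_geRe.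
- apply: le_trans (le_normr_Rintegral _ f2) _ => //; apply: le_Rintegral => //.
    exact: integrable_norm.
  by move=> t _; rewrite (le_trans _ (fG t))// normc_geIm.
Qed.

Lemma Rintegral_dominated (f_ : nat -> R -> R) (f G : R -> R) :
  (forall n, measurable_fun setT (f_ n)) -> (forall t, f_ n t @[n --> \oo] --> f t) ->
  mu.-integrable setT (EFin \o G) -> (forall n t, `|f_ n t| <= G t) ->
  mu.-integrable setT (EFin \o f) /\ \int[mu]_t f_ n t @[n --> \oo] --> \int[mu]_t f t.
Proof.
move=> mf fl iG fG.
have mf' : measurable_fun setT f by exact: (@measurable_fun_cvg _ _ _ _ f_).
have [] := @dominated_convergence _ _ _ mu _ measurableT
  (fun n => EFin \o f_ n) (EFin \o f) (EFin \o G).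
- by move=> n; apply/measurable_EFinP; exact: mf.
- apply/measurable_EFinP; exact: mf'.
- by apply: aeW => t _; apply: cvg_EFin; [by near=> n|exact: fl].
- exact: iG.
- by apply: aeW => t n _ /=; rewrite lee_fin.
move=> fi _ cv; split => //.
by apply: fine_cvg; rewrite fineK//; exact: integrable_fin_num.
Unshelve. all: by end_near. Qed.

Lemma cintegral_dominated (f_ : nat -> R -> R[i]^o) (f : R -> R[i]^o) (G : R -> R) :
  (forall n, cmeasurable (f_ n)) -> (forall t, f_ n t @[n --> \oo] --> f t) ->
  mu.-integrable setT (EFin \o G) -> (forall n t, normc (f_ n t) <= G t) ->
  cintegrable f /\ (cintegral (f_ n) : R[i]^o) @[n --> \oo] --> (cintegral f : R[i]^o).
Proof.
move=> mf fl iG fG.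
have [] := @Rintegral_dominated (fun n t => cRe (f_ n t)) (fun t => cRe (f t)) G.
- by move=> n; case: (mf n).
- by move=> t; have /cvg_complexP[] := fl t.
- by [].
- by move=> n t; rewrite (le_trans (normc_geRe _))//.
move=> i1 c1.
have [] := @Rintegral_dominated (fun n t => cIm (f_ n t)) (fun t => cIm (f t)) G.
- by move=> n; case: (mf n).
- by move=> t; have /cvg_complexP[] := fl t.
- by [].
- by move=> n t; rewrite (le_trans (normc_geIm _))//.
move=> i2 c2; split => //.
by apply/cvg_complexP; split.
Qed.

End CIntegral.

(** * Square-integrable functions *)

Section L2.
Context {R : realType}.
Implicit Types f g : R -> R[i].
Import Normc.
Local Notation mu := (@lebesgue_measure R).

Lemma ecvg0P (u : nat -> \bar R) : (forall n, (0 <= u n)%E) ->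
  (u n @[n --> \oo] --> 0%E) <-> forall e : R, 0 < e -> \forall n \near \oo, (u n <= e%:E)%E.
Proof.
move=> u0; split.
- move=> /fine_cvgP[ufin /cvgrPdist_le ul] e e0; near=> n.
  have un : u n \is a fin_num by near: n.
  rewrite -(fineK un) lee_fin.
  have : `|0 - fine (u n)| <= e by near: n; exact: ul.
  by rewrite sub0r normrN ger0_norm ?fine_ge0.
- move=> h; apply/fine_cvgP; split.
    near=> n; rewrite ge0_fin_numE//; apply: (@le_lt_trans _ _ 1%:E); last exact: ltry.
    by near: n; exact: h.
  apply/cvgrPdist_le => e e0; near=> n.
  have un : (u n <= e%:E)%E by near: n; exact: h.
  rewrite sub0r normrN /= ger0_norm ?fine_ge0// -lee_fin fineK//.
  by rewrite ge0_fin_numE//; apply: le_lt_trans un _; exact: ltry.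
Unshelve. all: by end_near. Qed.

(** The square of the L^2 norm. Estimates are carried out on it to stay clear of roots of extended
    reals; [cLnorm2E] and [cvg_cLnorm2] translate back. *)
Definition sqn f : \bar R := (\int[mu]_t ((normc (f t)) ^+ 2)%:E)%E.

Lemma sqn_ge0 f : (0 <= sqn f)%E.
Proof. by apply: integral_ge0 => t _; rewrite lee_fin sqr_ge0. Qed.

Lemma cLnorm2E f : cLnorm 2 f = (sqn f `^ 2^-1)%E.
Proof.
rewrite /cLnorm unlock /sqn; congr (_ `^ _)%E.
apply: eq_integral => t _; rewrite gee0_abs ?lee_fin ?normc_ge0// poweR_EFin.
by rewrite powR_mulrn// normc_ge0.
Qed.

Lemma measurable_sqn f : cmeasurable f ->
  measurable_fun setT (fun t => ((normc (f t)) ^+ 2)%:E).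
Proof.
by move=> mf; apply/measurable_EFinP; apply: measurable_funX; exact: measurable_normc.
Qed.

Lemma inL2P f : inL2 f <-> cmeasurable f /\ (sqn f < +oo)%E.
Proof.
rewrite /inL2 cLnorm2E; split => -[mf h]; split => //; last exact: poweR_lty.
by apply: lty_poweRy h; rewrite invr_neq0.
Qed.

Lemma inL2_fin f : inL2 f -> sqn f \is a fin_num.
Proof. by move=> /inL2P[_ h]; rewrite ge0_fin_numE// sqn_ge0. Qed.

Lemma inL2_integrable f : inL2 f ->
  mu.-integrable setT (EFin \o (fun t => (normc (f t)) ^+ 2)).
Proof.
move=> /inL2P[mf h]; apply/integrableP; split; first exact: measurable_sqn.
rewrite (_ : (\int[mu]_x _)%E = sqn f)//; apply: eq_integral => t _ /=.
by rewrite ger0_norm// sqr_ge0.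
Qed.

Lemma integrable_inL2 f : cmeasurable f ->
  mu.-integrable setT (EFin \o (fun t => (normc (f t)) ^+ 2)) -> inL2 f.
Proof.
move=> mf /integrableP[_ h]; apply/inL2P; split => //.
rewrite (_ : sqn f = (\int[mu]_x `|(EFin \o (fun t => (normc (f t)) ^+ 2)%R) x|)%E)//.
by apply: eq_integral => t _ /=; rewrite ger0_norm// sqr_ge0.
Qed.

Lemma inL1P f : inL1 f <-> cintegrable f.
Proof.
rewrite /inL1 /cLnorm Lnorm1; split.
- move=> [mf h]; apply: (@cintegrable_le _ _ (fun t => normc (f t))) => //.
  by apply/integrableP; split => //; apply/measurable_EFinP; exact: measurable_normc.
- move=> cf; split; first exact: cintegrable_meas.
  by have /integrableP[_] := cintegrable_normc cf.
Qed.

Lemma eq_sqn f g : (forall t, normc (f t) = normc (g t)) -> sqn f = sqn g.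
Proof. by move=> fg; apply: eq_integral => t _; rewrite fg. Qed.

Lemma le_sqn f g : (forall t, normc (f t) <= normc (g t)) -> cmeasurable f -> cmeasurable g ->
  (sqn f <= sqn g)%E.
Proof.
move=> fg mf mg; apply: ge0_le_integral => //.
- by move=> t _; rewrite lee_fin sqr_ge0.
- exact: measurable_sqn.
- exact: measurable_sqn.
- by move=> t _; rewrite lee_fin ler_sqr ?nnegrE ?normc_ge0.
Qed.

Lemma sqnC f g : sqn (fun t => f t - g t) = sqn (fun t => g t - f t).
Proof. by apply: eq_sqn => t; rewrite -normcN opprB. Qed.

(** Integrated form of |a + b|^2 <= 2 |a|^2 + 2 |b|^2, the triangle inequality of squared norms; the
    factors 2 are harmless where a quantity only has to be finite or tend to 0. *)
Lemma sqnD f g : cmeasurable f -> cmeasurable g ->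
  (sqn (fun t => f t + g t)%R <= 2%:E * sqn f + 2%:E * sqn g)%E.
Proof.
move=> mf mg; have mf2 := measurable_sqn mf; have mg2 := measurable_sqn mg.
rewrite /sqn -!ge0_integralZl ?lee_fin//; last 2 first.
- by move=> t _; rewrite lee_fin sqr_ge0.
- by move=> t _; rewrite lee_fin sqr_ge0.
rewrite -ge0_integralD//; last 4 first.
- by move=> t _; rewrite -EFinM lee_fin mulr_ge0// sqr_ge0.
- exact: measurable_funeM.
- by move=> t _; rewrite -EFinM lee_fin mulr_ge0// sqr_ge0.
- exact: measurable_funeM.
apply: ge0_le_integral => //.
- by move=> t _; rewrite lee_fin sqr_ge0.
- by apply: measurable_sqn; exact: cmeasurableD.
- by apply: emeasurable_funD; exact: measurable_funeM.
move=> t _; rewrite -!EFinM -EFinD lee_fin.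
have h := le_normcD (f t) (g t).
have h0 := normc_ge0 (f t + g t); have h1 := normc_ge0 (f t); have h2 := normc_ge0 (g t).
apply: (@le_trans _ _ ((normc (f t) + normc (g t)) ^+ 2)).
  by rewrite ler_sqr ?nnegrE ?addr_ge0.
have := sqr_ge0 (normc (f t) - normc (g t)); rewrite !expr2; lra.
Qed.

Lemma inL2D f g : inL2 f -> inL2 g -> inL2 (fun t => f t + g t).
Proof.
move=> /inL2P[mf f2] /inL2P[mg g2]; apply/inL2P; split; first exact: cmeasurableD.
apply: le_lt_trans (sqnD mf mg) _; rewrite lte_add_pinfty//;
by rewrite lte_mul_pinfty// ge0_fin_numE.
Qed.

Lemma inL2N f : inL2 f -> inL2 (fun t => - f t).
Proof.
move=> /inL2P[[m1 m2] f2]; apply/inL2P; split.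
  split.
  - rewrite (_ : (fun _ => _) = (fun t => - cRe (f t))); first exact: measurableT_comp.
    by apply/funext => t; case: (f t).
  - rewrite (_ : (fun _ => _) = (fun t => - cIm (f t))); first exact: measurableT_comp.
    by apply/funext => t; case: (f t).
by rewrite (@eq_sqn _ f)// => t; rewrite normcN.
Qed.

Lemma inL2B f g : inL2 f -> inL2 g -> inL2 (fun t => f t - g t).
Proof. by move=> hf hg; exact: inL2D hf (inL2N hg). Qed.

Lemma sqnB f g k : cmeasurable f -> cmeasurable g -> cmeasurable k ->
  (sqn (fun t => f t - g t)%R <=
    2%:E * sqn (fun t => f t - k t)%R + 2%:E * sqn (fun t => k t - g t)%R)%E.
Proof.
move=> mf mg mk; have := sqnD (cmeasurableB mf mk) (cmeasurableB mk mg).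
by congr (_ <= _)%E; apply: eq_sqn => t; rewrite addrA subrK.
Qed.

(** The weighted inequality 2ab <= c a^2 + b^2 / c. The free weight c does the work of
    Cauchy-Schwarz: a large c lets a very small |f| compensate a merely bounded |g|. *)
Lemma inner_dominated f g (c : R) : 0 < c -> inL2 f -> inL2 g ->
  let G t := 2^-1 * (c * normc (f t) ^+ 2 + c^-1 * normc (g t) ^+ 2) in
  [/\ mu.-integrable setT (EFin \o G),
     \int[mu]_t G t = 2^-1 * (c * fine (sqn f) + c^-1 * fine (sqn g)) &
     forall t, normc (f t * (g t)^*%C) <= G t].
Proof.
move=> c0 f2 g2 G.
have if2 := inL2_integrable f2; have ig2 := inL2_integrable g2.
have i1 := integrableZl measurableT c if2; have i2 := integrableZl measurableT c^-1 ig2.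
have i3 := integrableD measurableT i1 i2.
split.
- exact: (integrableZl measurableT (2^-1) i3).
- by rewrite RintegralZl// RintegralD// !RintegralZl.
- move=> t; rewrite normcM normc_conj /G.
  have h1 := normc_ge0 (f t); have h2 := normc_ge0 (g t).
  set a := normc (f t) in h1 *; set b := normc (g t) in h2 *.
  (* The difference of the two sides is a square up to a positive factor. *)
  rewrite -subr_ge0 (_ : _ - _ = 2^-1 * c^-1 * (c * a - b) ^+ 2); last by field; lra.
  by rewrite mulr_ge0 ?sqr_ge0// mulr_ge0// invr_ge0 ltW.
Qed.

Lemma inner_integrable f g : inL2 f -> inL2 g -> cintegrable (fun t => f t * (g t)^*%C).
Proof.
move=> f2 g2; have [i _ h] := inner_dominated ltr01 f2 g2.
apply: cintegrable_le i h.
by apply: cmeasurableM; [case: f2|apply: cmeasurable_conj; case: g2].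
Qed.

Lemma normc_inner_le f g (c : R) : 0 < c -> inL2 f -> inL2 g ->
  normc (inner f g) <= c * fine (sqn f) + c^-1 * fine (sqn g).
Proof.
move=> c0 f2 g2; have [i ig h] := inner_dominated c0 f2 g2.
have mfg : cmeasurable (fun t => f t * (g t)^*%C).
  by apply: cmeasurableM; [case: f2|apply: cmeasurable_conj; case: g2].
by apply: le_trans (le_normc_cintegral mfg i h) _; rewrite ig mulrA divff ?mul1r.
Qed.

(** For the real part alone the constant 1/2 is kept, whereas [normc_inner_le] loses a factor 2. It
    matters in [sqn_fourierL1_le], where half of a squared norm is absorbed by the other side. *)
Lemma Re_inner_le f g : inL2 f -> inL2 g ->
  cRe (inner f g) <= 2^-1 * (fine (sqn f) + fine (sqn g)).
Proof.
move=> f2 g2; have [i + h] := inner_dominated ltr01 f2 g2.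
rewrite [X in _ = X -> _](_ : _ = 2^-1 * (fine (sqn f) + fine (sqn g))); last first.
  by rewrite invr1 !mul1r.
move=> <-; have [i1 _] := inner_integrable f2 g2.
apply: le_Rintegral => // t _.
by rewrite (le_trans _ (h t))// (le_trans (ler_norm _))// normc_geRe.
Qed.

Lemma innerDl f g k : inL2 f -> inL2 g -> inL2 k ->
  inner (fun t => f t + g t) k = inner f k + inner g k.
Proof.
move=> f2 g2 k2; rewrite /inner -cintegralD; try exact: inner_integrable.
by congr cintegral; apply/funext => t; rewrite mulrDl.
Qed.

Lemma innerNl f k : inL2 f -> inL2 k -> inner (fun t => - f t) k = - inner f k.
Proof.
move=> f2 k2; rewrite /inner -[RHS]mulN1r -cintegralZ; last exact: inner_integrable.
by congr cintegral; apply/funext => t; rewrite mulN1r mulNr.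
Qed.

Lemma innerBl f g k : inL2 f -> inL2 g -> inL2 k ->
  inner (fun t => f t - g t) k = inner f k - inner g k.
Proof. by move=> f2 g2 k2; rewrite innerDl// ?innerNl//; exact: inL2N. Qed.

Lemma inner_self f : inL2 f -> inner f f = (fine (sqn f))%:C.
Proof.
move=> f2; rewrite /inner; under eq_fun do rewrite mulcJ.
by rewrite /cintegral /= Rintegral_cst// mul0r.
Qed.

End L2.

(** * Scaling of Lebesgue measure *)

Section Scaling.
Context {R : realType}.
Import Normc.
Local Notation mu := (@lebesgue_measure R).
Variables (a : R) (a0 : 0 < a).

Let an : {nonneg R} := NngNum (ltW a0).

(** Lebesgue measure is determined by its values on the intervals ]x, y], whose preimages ]x/a, y/a]
    have length (y - x)/a; the factor a of [mscale] restores y - x. *)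
Lemma lebesgue_measure_scale (A : set R) : measurable A ->
  pushforward (mscale an mu) (fun t => a * t : measurableTypeR R) A = mu A.
Proof.
move=> mA; apply/esym/lebesgue_measure_unique => //=; first exact: mulrl_measurable.
move=> ms _ [[x y]] _ <-.
rewrite /pushforward /mscale/= (_ : _ @^-1` _ = `]x / a, y / a]%classic); last first.
  apply/seteqP; split => t /=; rewrite !in_itv/= ltr_pdivrMr// ler_pdivlMr//;
  by rewrite (mulrC a).
rewrite !lebesgue_measure_itv/= !lte_fin ltr_pM2r ?invr_gt0//.
case: ifPn => _; last by rewrite mule0.
by rewrite -!EFinB -EFinM; congr (_%:E); field; rewrite gt_eqF.
Qed.

Lemma ge0_integral_scale (f : R -> \bar R) :
  measurable_fun setT f -> (forall t, (0 <= f t)%E) ->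
  (\int[mu]_t f (a * t)%R = (a^-1)%:E * \int[mu]_t f t)%E.
Proof.
move=> mf f0.
have ms : measurable_fun setT (fun t : measurableTypeR R => a * t : measurableTypeR R).
  exact: mulrl_measurable.
have -> : (\int[mu]_t f t =
    \int[pushforward (mscale an mu) (fun t => (a * t)%R : measurableTypeR R)]_t f t)%E.
  by apply: eq_measure_integral => // A mA _; exact/esym/lebesgue_measure_scale.
rewrite ge0_integral_pushforward// preimage_setT ge0_integral_mscale//.
  by rewrite muleA -EFinM /= mulVf ?mul1e// gt_eqF.
  exact: measurableT_comp mf ms.
by move=> t _; exact: f0.
Qed.

Lemma integrable_scale (f : R -> R) : mu.-integrable setT (EFin \o f) ->
  mu.-integrable setT (EFin \o (fun t => f (a * t))).
Proof.
move=> /integrableP[mf fi]; apply/integrableP; split.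
  exact: (measurableT_comp mf (mulrl_measurable a)).
rewrite (@ge0_integral_scale (fun t => `|(EFin \o f) t|)%E)//; last first.
  exact: measurableT_comp.
by rewrite lte_mul_pinfty// lee_fin invr_ge0 ltW.
Qed.

Lemma Rintegral_scale (f : R -> R) : mu.-integrable setT (EFin \o f) ->
  \int[mu]_t f (a * t) = a^-1 * \int[mu]_t f t.
Proof.
move=> fi; have mf := measurable_int _ fi.
have mfp := measurable_funepos mf; have mfn := measurable_funeneg mf.
have h1 : (\int[mu]_t (f (a * t))%:E)%E = ((a^-1)%:E * \int[mu]_t (f t)%:E)%E.
  rewrite [LHS]integralE [X in (_ = _ * X)%E]integralE.
  rewrite muleBr//; last exact: integrable_add_def.
  rewrite -(ge0_integral_scale mfp)// -(ge0_integral_scale mfn)//.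
  by congr (_ - _)%E; apply: eq_integral => t _; rewrite ?funeposE ?funenegE.
rewrite /Rintegral h1 fineM//; exact: integrable_fin_num.
Qed.

Lemma cintegrable_scale (f : R -> R[i]) : cintegrable f -> cintegrable (fun t => f (a * t)).
Proof.
by move=> [f1 f2]; split; [exact: (integrable_scale f1)|exact: (integrable_scale f2)].
Qed.

Lemma cintegral_scale (f : R -> R[i]) : cintegrable f ->
  cintegral (fun t => f (a * t)) = (a^-1)%:C * cintegral f.
Proof.
move=> [f1 f2]; rewrite /cintegral (Rintegral_scale f1) (Rintegral_scale f2).
by simpc.
Qed.

End Scaling.

(** * Riemann sums as integrals of step functions *)

(** The integers of absolute value at most B, as a list without repetition over which integrals can
    be exchanged with sums by linearity. *)
Definition zrange (B : nat) : seq int := [seq i%:Z - B%:Z | i <- iota 0 (2 * B).+1].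

Lemma zrange_uniq B : uniq (zrange B).
Proof. by rewrite map_inj_uniq ?iota_uniq// => i j /addIr[]. Qed.

Lemma mem_zrange B (k : int) : (k \in zrange B) = (`|k| <= B%:Z).
Proof.
apply/mapP/idP => [[j] + | kB].
  rewrite mem_iota => /andP[_ +] ->; rewrite add0n ltnS => jB.
  by rewrite ler_norml; apply/andP; split; lia.
move: kB; rewrite ler_norml => /andP[h1 h2].
exists (absz (k + B%:Z)); first by rewrite mem_iota; lia.
lia.
Qed.

Lemma fsbig_zrange (R : zmodType) B (F : int -> R) :
  (forall k, k \notin zrange B -> F k = 0) ->
  \sum_(k \in [set: int]) F k = \sum_(k <- zrange B) F k.
Proof.
move=> F0; rewrite -(@fsbig_widen int R 0 +%R [set` zrange B] setT F)//; last first.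
  by move=> k [_ kB] /=; apply: F0; apply/negP.
by rewrite -fsbig_seq // zrange_uniq.
Qed.

Section Riemann.
Context {R : realType}.
Import Normc.
Local Notation mu := (@lebesgue_measure R).

(* The grid of the points 2 m / N, m in eps + Z; [gridi] is the cell containing y. *)
Definition gridi (eps N y : R) : int := Num.floor (y * N / 2 - eps).
Definition node (eps N : R) (k : int) : R := 2 * (eps + k%:~R) / N.

Lemma gridiP eps N y k : 0 < N ->
  (gridi eps N y == k) = (y \in `[node eps N k, node eps N k + 2 / N[).
Proof.
move=> N0; rewrite floor_eq in_itv/= /node; congr (_ && _).
  rewrite lerBrDl ler_pdivrMr// ler_pdivlMr// mulrC [in RHS]mulrC.
  by congr (_ <= _); ring.
rewrite -mulrDl ltr_pdivlMr// ltrBlDl ltr_pdivrMr// intrD.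
by congr (_ < _); ring.
Qed.

Lemma gridi_dist eps N y : 0 < N -> `|y - node eps N (gridi eps N y)| <= 2 / N.
Proof.
move=> N0; have := gridiP eps y (gridi eps N y) N0; rewrite eqxx => /esym.
rewrite in_itv/= => /andP[h1 h2].
by rewrite ger0_norm ?subr_ge0// lerBlDl ltW.
Qed.

Let cell eps N k : set R := [set` `[node eps N k, node eps N k + 2 / N[].

Let indic_cellE eps N k y : 0 < N -> \1_(cell eps N k) y = (gridi eps N y == k)%:R :> R.
Proof.
move=> N0; rewrite indicE gridiP//; by rewrite mem_setE.
Qed.

(** The cells partition the line, so at each y at most one term of the sum is nonzero. *)
Let step_sum eps N B (phi : int -> R[i]) : 0 < N ->
  (forall k, k \notin zrange B -> phi k = 0) ->
  (fun y => phi (gridi eps N y)) =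
  (fun y => \sum_(k <- zrange B) phi k * (\1_(cell eps N k) y)%:C).
Proof.
move=> N0 phi0; apply/funext => y.
have [kB|kB] := boolP (gridi eps N y \in zrange B).
  rewrite (bigD1_seq _ kB (zrange_uniq B))/= indic_cellE// eqxx mulr1 big1 ?addr0// => k kg.
  by rewrite indic_cellE// eq_sym (negbTE kg) mulr0.
rewrite phi0// big1_seq// => k /= kB'; rewrite indic_cellE//.
by case: eqP kB => [->|_ _]; [rewrite kB'|rewrite mulr0].
Qed.

Let cell_int eps N k : 0 < N -> cintegrable (fun y => (\1_(cell eps N k) y : R)%:C).
Proof.
move=> N0; split => /=; first exact: integrable_indic_itv.
by rewrite (_ : EFin \o _ = cst 0%E)//; exact: integrable0.
Qed.

Lemma cintegrable_step eps N B (phi : int -> R[i]) : 0 < N ->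
  (forall k, k \notin zrange B -> phi k = 0) -> cintegrable (fun y => phi (gridi eps N y)).
Proof.
move=> N0 phi0; rewrite (step_sum eps N0 phi0); apply: cintegrable_sum => k.
by apply: cintegrableZ; exact: cell_int.
Qed.

(** Every cell has length 2/N: a Riemann sum with this mesh is, without any error term, the integral
    of a step function. *)
Lemma cintegral_step eps N B (phi : int -> R[i]) : 0 < N ->
  (forall k, k \notin zrange B -> phi k = 0) ->
  cintegral (fun y => phi (gridi eps N y)) = (2 / N)%:C * \sum_(k \in [set: int]) phi k.
Proof.
move=> N0 phi0; rewrite (step_sum eps N0 phi0) cintegral_sum; last first.
  by move=> k; apply: cintegrableZ; exact: cell_int.
rewrite (fsbig_zrange phi0) mulr_sumr; apply: eq_bigr => k _.
rewrite cintegralZ; last exact: cell_int.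
rewrite mulrC; congr (_ * _); rewrite /cintegral /= Rintegral_cst// mul0r; congr (_ +i* _).
rewrite /Rintegral integral_indic//; last exact: measurable_itv.
rewrite setIT; transitivity (fine ((2 / N)%:E)) => //; congr fine.
apply: etrans (lebesgue_measure_itv _) _.
by rewrite /= lte_fin ltrDl divr_gt0// -EFinB addrAC subrr add0r.
Qed.

Lemma cvg_node_gridi eps (N : nat -> R) y : N n @[n --> \oo] --> +oo ->
  node eps (N n) (gridi eps (N n) y) @[n --> \oo] --> y.
Proof.
move=> Noo; apply/cvgrPdist_le => e e0; near=> n.
have N0 : 2 / e < N n by near: n; move/cvgryPgt : Noo; apply.
have N0' : 0 < N n by apply: lt_trans N0; rewrite divr_gt0.
rewrite (le_trans (gridi_dist _ _ N0'))// ler_pdivrMr// mulrC -ler_pdivrMr//.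
exact: ltW.
Unshelve. all: by end_near. Qed.

End Riemann.

(** * Complex exponentials and rescaled basis vectors *)

Section FTCline.
Context {R : realType}.
Local Notation mu := (@lebesgue_measure R).
Variables f F : R -> R.
Hypothesis cf : continuous f.
Hypothesis dF : forall x : R, is_derive x 1 F (f x).

Let cF : continuous F.
Proof. by move=> x; apply: differentiable_continuous; apply/derivable1_diffP. Qed.

(** The endpoints are [n.+1] and its opposite so that the interval is never reduced to a point, as
    the fundamental theorem of calculus requires. *)
Let FTC_itv (n : nat) :
  (\int[mu]_(x in `[(- n.+1%:R)%R, n.+1%:R%R]) (f x)%:E = (F n.+1%:R - F (- n.+1%:R))%:E)%E.
Proof.
rewrite (@continuous_FTC2 _ f F) ?EFinB//.
- by rewrite -subr_gt0 opprK addr_gt0.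
- exact: continuous_subspaceT.
- split => [x _| |].
  + by have [] := dF x.
  + exact/cvg_at_right_filter/cF.
  + exact/cvg_at_left_filter/cF.
- by move=> x _; rewrite derive1E derive_val.
Qed.

Let mf : measurable_fun setT f.
Proof. exact: continuous_measurable_fun. Qed.

Let f_ (n : nat) := f \_ `[- n.+1%:R, n.+1%:R]%classic.

Let mf_ n : measurable_fun setT (f_ n).
Proof.
by apply/(measurable_restrictT _ _).1; [exact: measurable_itv|exact: measurable_funTS].
Qed.

Let f_E n x : (`|x| <= n.+1%:R) -> f_ n x = f x.
Proof. by move=> xn; rewrite /f_ patchE mem_set//= in_itv/= -ler_norml. Qed.

Let f_0 n x : ~~ (`|x| <= n.+1%:R) -> f_ n x = 0.
Proof.
move=> xn; rewrite /f_ patchE memNset//= in_itv/= -ler_norml; exact/negP.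
Qed.

Let f_cvg x : f_ n x @[n --> \oo] --> f x.
Proof.
apply: cvg_near_cst; near=> n; apply: f_E.
apply: (@le_trans _ _ n%:R); last by rewrite ler_nat.
by near: n; exact: nbhs_infty_ger.
Unshelve. all: by end_near. Qed.

Let int_f_ n : (\int[mu]_x (f_ n x)%:E = (F n.+1%:R - F (- n.+1%:R))%:E)%E.
Proof.
by rewrite -FTC_itv [RHS]integral_mkcond/= restrict_EFin.
Qed.

(** Restrictions of f to growing intervals are dominated by |f|. The integrability assumed here is
    supplied, for the weight of the waves, by monotone convergence in [FTC_line_integrable]. *)
Lemma FTC_line_cvg (L : R) : mu.-integrable setT (EFin \o f) ->
  F n.+1%:R - F (- n.+1%:R) @[n --> \oo] --> L -> \int[mu]_x f x = L.
Proof.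
move=> fi FL.
have [||_ +] := @Rintegral_dominated _ f_ f (fun x => `|f x|) mf_ f_cvg.
- exact: integrable_norm.
- move=> n x; case: (boolP (`|x| <= n.+1%:R)) => xn; first by rewrite f_E.
  by rewrite f_0// normr0.
rewrite (_ : (fun n => _) = (fun n : nat => F n.+1%:R - F (- n.+1%:R))); last first.
  by apply/funext => n; rewrite /Rintegral int_f_.
by move=> h; apply: cvg_unique h FL.
Qed.

Lemma FTC_line_integrable (C : R) : (forall x, 0 <= f x) ->
  (forall n : nat, F n.+1%:R - F (- n.+1%:R) <= C) -> mu.-integrable setT (EFin \o f).
Proof.
move=> f0 FC; apply/integrableP; split; first exact/measurable_EFinP.
have f_ge0 n x : 0 <= f_ n x.
  case: (boolP (`|x| <= n.+1%:R)) => xn; first by rewrite f_E.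
  by rewrite f_0.
have nd x : {homo (fun n => (f_ n x)%:E) : n m / (n <= m)%N >-> (n <= m)%E}.
  move=> n m nm; rewrite lee_fin.
  case: (boolP (`|x| <= n.+1%:R)) => xn; last by rewrite f_0.
  by rewrite !f_E// (le_trans xn)// ler_nat ltnS.
have := @monotone_convergence _ _ _ mu _ measurableT (fun n x => (f_ n x)%:E)
  (fun n => (measurable_EFinP _ _).2 (mf_ n)) (fun n x _ => f_ge0 n x) (fun x _ => nd x).
under eq_integral => x _.
  rewrite (_ : limn _ = (`|(EFin \o f) x|)%E); last first.
    apply/cvg_lim => //=; rewrite ger0_norm//; apply: cvg_EFin; first exact: nearW.
    exact: f_cvg.
  over.
move=> ->; apply: (@le_lt_trans _ _ C%:E); last exact: ltry.
apply: lime_le.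
  apply: ereal_nondecreasing_is_cvgn => n m nm; apply: ge0_le_integral => //.
  - by move=> x _; rewrite lee_fin.
  - by apply/measurable_EFinP; exact: mf_.
  - by apply/measurable_EFinP; exact: mf_.
  - by move=> x _; exact: nd.
by apply: nearW => n /=; rewrite int_f_ lee_fin.
Qed.

End FTCline.

(** * The exponential and the pointwise limit of the waves *)

Section Exponential.
Context {R : realType}.
Import Normc.
Implicit Types z w : R[i].
Local Notation mu := (@lebesgue_measure R).

Lemma normc_cexp z : normc (cexp z) = expR (cRe z).
Proof.
rewrite /cexp normcM normc_real ger0_norm ?expR_ge0//=.
by rewrite cos2Dsin2 sqrtr1 mulr1.
Qed.

Lemma cexpD z w : cexp (z + w) = cexp z * cexp w.
Proof.
rewrite /cexp ReD ImD expRD cosD sinD rmorphM/= mulrACA; congr (_ * _).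
by simpc; congr (_ +i* _); rewrite addrC.
Qed.

Lemma cexp0 : cexp 0 = 1 :> R[i].
Proof. by rewrite /cexp /= expR0 cos0 sin0 mul1r. Qed.

Lemma cexp_neq0 z : cexp z != 0.
Proof.
apply/eqP => /(congr1 (@normc R)); rewrite normc_cexp normc0 => /eqP.
by rewrite gt_eqF ?expR_gt0.
Qed.

Lemma cexp_conj z : (cexp z)^*%C = cexp (z^*)%C.
Proof.
case: z => a b; rewrite /cexp rmorphM/= oppr0 cosN sinN; congr (_ * _).
Qed.

Lemma cvg_cexp (T : Type) (F : set_system T) {FF : Filter F}
    (u : T -> R[i]^o) (l : R[i]^o) :
  u @ F --> l -> (cexp (u t) : R[i]^o) @[t --> F] --> (cexp l : R[i]^o).
Proof.
move=> /cvg_complexP[u1 u2].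
have e1 : expR (cRe (u t)) @[t --> F] --> expR (cRe l).
  exact: (continuous_cvg _ (@continuous_expR R _) u1).
have c1 : cos (cIm (u t)) @[t --> F] --> cos (cIm l).
  exact: (continuous_cvg _ (@continuous_cos R _) u2).
have s1 : sin (cIm (u t)) @[t --> F] --> sin (cIm l).
  exact: (continuous_cvg _ (@continuous_sin R _) u2).
apply/cvg_complexP; split.
- under eq_fun do rewrite /cexp /= mul0r subr0.
  by rewrite /cexp /= mul0r subr0; exact: cvgM.
- under eq_fun do rewrite /cexp /= mul0r addr0.
  by rewrite /cexp /= mul0r addr0; exact: cvgM.
Qed.

Lemma cmeasurable_cexp (f : R -> R[i]) : cmeasurable f -> cmeasurable (fun t => cexp (f t)).
Proof.
move=> [f1 f2].
have me := measurableT_comp (continuous_measurable_fun (@continuous_expR R)) f1.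
have mc := measurableT_comp (continuous_measurable_fun (@continuous_cos R)) f2.
have ms := measurableT_comp (continuous_measurable_fun (@continuous_sin R)) f2.
split.
- under eq_fun do rewrite /cexp /= mul0r subr0.
  exact: measurable_funM.
- under eq_fun do rewrite /cexp /= mul0r addr0.
  exact: measurable_funM.
Qed.

(* With N = x^2, t = s / N and y = 2 m / N this is basis_e lambda m t without its
   constant factor. *)
Definition wave (lambda N y s : R) : R[i] :=
  cexp (0 +i* (y * (N * atan (s / N)))) * cpow ((s / N) ^+ 2 + 1) (ell lambda).

Lemma sqrD1_gt0 (a : R) : 0 < a ^+ 2 + 1.
Proof. by rewrite ltr_wpDl ?sqr_ge0. Qed.

(** The phase has modulus 1 and Re ell = -1/2, so |a^ell|^2 = 1/a for a > 0. *)
Lemma sqr_normc_wave lambda N y s : normc (wave lambda N y s) ^+ 2 = ((s / N) ^+ 2 + 1)^-1.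
Proof.
have p := sqrD1_gt0 (s / N).
rewrite /wave normcM !normc_cexp /= expR0 mul1r mulr0 subr0 -expRM_natl.
by rewrite mulNr mulrN mulrA divff ?mul1r// -lnV ?posrE// lnK// posrE invr_gt0.
Qed.

Lemma normc_wave_le1 lambda N y s : normc (wave lambda N y s) <= 1.
Proof.
rewrite -(@ler_sqr _ _ 1) ?nnegrE ?normc_ge0// sqr_normc_wave expr1n invf_le1 ?sqrD1_gt0//.
by rewrite lerDr sqr_ge0.
Qed.

Lemma cmeasurable_wave lambda N y : cmeasurable (wave lambda N y).
Proof.
apply: cmeasurableM; apply: cmeasurable_cexp.
  split => /=; first exact: measurable_cst.
  apply: measurable_funM; first exact: measurable_cst.
  apply: measurable_funM; first exact: measurable_cst.
  apply: (measurableT_comp (continuous_measurable_fun (@continuous_atan R))).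
  exact: mulrr_measurable.
apply: cmeasurableM; first exact: cmeasurable_cst.
split => /=; last exact: measurable_cst.
apply: (measurableT_comp (@measurable_ln R)).
apply: measurable_funD; last exact: measurable_cst.
by apply: measurable_funX; exact: mulrr_measurable.
Qed.

(** This is s times the difference quotient of atan at 0 with increment s/N, and atan'(0) = 1. The
    case s = 0 is set apart because the increment has to avoid 0. *)
Lemma cvg_mul_atan (N : nat -> R) s : N n @[n --> \oo] --> +oo ->
  N n * atan (s / N n) @[n --> \oo] --> s.
Proof.
move=> Noo.
have [->|s0] := eqVneq s 0.
  by under eq_fun do rewrite mul0r atan0 mulr0; exact: cvg_cst.
have N0 : \forall n \near \oo, 0 < N n by move/cvgryPgt : Noo; apply.
have h0 : s / N n @[n --> \oo] --> 0.
  apply/cvgr0Pnorm_lt => e e0; near=> n.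
  have Nn : 0 < N n by near: n.
  rewrite normrM normfV (gtr0_norm Nn) ltr_pdivrMr// mulrC -ltr_pdivrMr//.
  by near: n; move/cvgryPgt : Noo; apply.
have hd : h^-1 * atan h @[h --> 0^'] --> (1 : R).
  have : (fun h : R => h^-1 *: (atan (h *: 1 + 0) - atan 0)) @ 0^' --> 'D_1 (@atan R) 0.
    exact: derivable_atan.
  have -> : 'D_1 (@atan R) 0 = 1.
    by have [_ ->] := is_derive1_atan (0 : R); rewrite expr0n addr0 invr1.
  rewrite (_ : (fun h : R => _) = (fun h => h^-1 * atan h))//.
  by apply/funext => h /=; rewrite atan0 subr0 addr0 scaler1.
have hn : s / N n @[n --> \oo] --> 0^'.
  move=> A hA; have := h0 _ hA; apply: filterS2 N0 => n /= Nn; apply.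
  by rewrite mulf_neq0// invr_neq0// gt_eqF.
have := cvg_comp _ _ hn hd => /(cvgM (cvg_cst s)); rewrite mulr1; apply: cvg_trans.
apply: near_eq_cvg; apply: filterS N0 => n Nn /=.
by rewrite invf_div mulrA mulrCA divff// mulr1.
Unshelve. all: by end_near. Qed.

(** The frequency varies with n because waves are sampled at the node of the cell of a point, which
    only converges to that point. *)
Lemma cvg_wave lambda (N y : nat -> R) (l s : R) : N n @[n --> \oo] --> +oo ->
  y n @[n --> \oo] --> l ->
  (wave lambda (N n) (y n) s : R[i]^o) @[n --> \oo] --> (cexp (0 +i* (l * s)) : R[i]^o).
Proof.
move=> Noo yl; rewrite -[cexp _]mulr1 -cexp0; apply: cvgM; apply: cvg_cexp.
  apply/cvg_complexP; split => /=; first exact: cvg_cst.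
  by apply: cvgM => //; exact: cvg_mul_atan.
have h : ln ((s / N n) ^+ 2 + 1) @[n --> \oo] --> 0.
  have hs : (s / N n) ^+ 2 + 1 @[n --> \oo] --> (1 : R).
    have V0 : (N n)^-1 @[n --> \oo] --> 0.
      apply/cvgr0Pnorm_lt => e e0; near=> n.
      have Nn : e^-1 < N n by near: n; move/cvgryPgt : Noo; apply.
      have Nn' : 0 < N n by apply: lt_trans Nn; rewrite invr_gt0.
      by rewrite normfV (gtr0_norm Nn') -[e]invrK ltf_pV2// posrE invr_gt0.
    have sV0 : s / N n @[n --> \oo] --> s * 0 by apply: cvgM V0; exact: cvg_cst.
    rewrite mulr0 in sV0.
    rewrite -[X in _ --> X]add0r -[X in _ --> X + _](mulr0 0).
    by apply: cvgD; [under eq_fun do rewrite expr2; exact: cvgM|exact: cvg_cst].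
  rewrite -[0](ln1 R); exact: (continuous_cvg _ (@continuous_ln R _ ltr01) hs).
apply/cvg_complexP; split.
- under eq_fun do rewrite /= mulr0 subr0.
  by rewrite /= -(mulr0 (- 2^-1)); apply: cvgM => //; exact: cvg_cst.
- under eq_fun do rewrite /= mulr0 add0r.
  by rewrite /= -(mulr0 lambda); apply: cvgM => //; exact: cvg_cst.
Unshelve. all: by end_near. Qed.

End Exponential.

(** * Orthogonality of the waves at the nodes *)

Section Orthogonality.
Context {R : realType}.
Import Normc.
Local Notation mu := (@lebesgue_measure R).

Lemma sin_intpi (j : int) : sin (j%:~R * pi) = 0 :> R.
Proof.
have sn (n : nat) : sin (n%:R * pi) = 0 :> R.
  elim: n => [|n ih]; first by rewrite mul0r sin0.
  by rewrite -natr1 mulrDl mul1r sinD sinpi mulr0 ih mul0r addr0.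
by case: (intP j) => [|n|n]; rewrite ?mul0r ?sin0//= ?mulrNz ?mulNr ?sinN sn// oppr0.
Qed.

Variables (N : R) (N0 : 0 < N).
(** The squared modulus of every wave, and N times the derivative of [th]. The substitution theta =
    [th s], with values in ]-pi/2, pi/2[, is carried out below through primitives that are functions
    of [th]. *)
Let w (s : R) := ((s / N) ^+ 2 + 1)^-1.
Let th (s : R) := atan (s / N).

Let w_ge0 s : 0 <= w s.
Proof. by rewrite invr_ge0 ltW// sqrD1_gt0. Qed.

Let is_derive_th (s : R) : is_derive s 1 th (w s / N).
Proof.
have dm : is_derive s 1 (fun s : R => s / N) N^-1.
  have := is_deriveZ N^-1 (is_derive_id s (1 : R)).
  rewrite [X in is_derive _ _ _ X](_ : _ = N^-1); last by rewrite /GRing.scale/= mulr1.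
  by rewrite (_ : _ \*: _ = (fun s : R => s / N))//; apply/funext => t; rewrite /= mulrC.
have := @is_derive1_comp _ atan (fun s => s / N) s _ _ (is_derive1_atan (s / N)) dm.
by rewrite /w addrC.
Qed.

Let continuous_th : continuous th.
Proof.
move=> s; apply: (continuous_cvg _ (@continuous_atan R _)).
by apply: cvgM; [exact: cvg_id|exact: cvg_cst].
Qed.

Let continuous_w : continuous w.
Proof.
move=> s; apply: cvgV; first by rewrite gt_eqF// sqrD1_gt0.
apply: cvgD; last exact: cvg_cst.
rewrite expr2; under eq_fun do rewrite expr2.
by apply: cvgM; apply: cvgM; (exact: cvg_id || exact: cvg_cst).
Qed.

Let cvg_th : th n.+1%:R @[n --> \oo] --> pi / 2.
Proof.
apply: (cvg_comp (fun n : nat => n.+1%:R / N) atan); last exact: cvgy_atan.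
apply/cvgryPgt => A; near=> n.
rewrite ltr_pdivlMr// (@lt_le_trans _ _ n%:R)// ?ler_nat//.
by near: n; exact: nbhs_infty_gtr.
Unshelve. all: by end_near. Qed.

Let thN s : th (- s) = - th s.
Proof. by rewrite /th mulNr atanN. Qed.

Lemma integrable_weight : mu.-integrable setT (EFin \o w).
Proof.
apply: (@FTC_line_integrable _ w (fun s => N * th s) _ _ (N * pi)) => //.
- move=> s; apply: is_derive_eq (is_deriveZ N (is_derive_th s)) _.
  by rewrite /GRing.scale/= mulrC divfK// gt_eqF.
- move=> n; rewrite thN (_ : _ - _ = N * (th n.+1%:R * 2)); last by ring.
  rewrite ler_pM2l//.
  by rewrite -ler_pdivlMr// ltW// atan_ltpi2.
Qed.

Lemma integral_weight : \int[mu]_s w s = N * pi.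
Proof.
apply: (@FTC_line_cvg _ w (fun s => N * th s)) => //.
- move=> s; apply: is_derive_eq (is_deriveZ N (is_derive_th s)) _.
  by rewrite /GRing.scale/= mulrC divfK// gt_eqF.
- exact: integrable_weight.
- rewrite (_ : (fun n : nat => _) = (fun n : nat => N * (th n.+1%:R * 2))); last first.
    by apply/funext => n; rewrite thN; ring.
  rewrite (_ : N * pi = N * (pi / 2 * 2)); last by rewrite divfK.
  by apply: cvgM; [exact: cvg_cst|apply: cvgM => //; exact: cvg_cst].
Qed.

Let integrable_trig (u : R -> R) : continuous u -> (forall s, `|u s| <= 1) ->
  mu.-integrable setT (EFin \o (fun s => u s * w s)).
Proof.
move=> cu u1; apply: le_integrable integrable_weight => //=.
  apply/measurable_EFinP; apply: measurable_funM; exact: continuous_measurable_fun.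
move=> s _; rewrite lee_fin normrM [leRHS]ger0_norm// (ger0_norm (w_ge0 s)).
by rewrite ler_piMl.
Qed.

Let continuous_lin (d : R) : continuous (fun s => d * th s).
Proof. by move=> s; apply: continuousM; [exact: cst_continuous|exact: continuous_th]. Qed.

Let is_derive_lin (d s : R) : is_derive s 1 (fun s => d * th s) (d * (w s / N)).
Proof. exact: (is_deriveZ d (is_derive_th s)). Qed.

Let continuous_cosl (d : R) : continuous (fun s => cos (d * th s)).
Proof.
by move=> s; apply: (continuous_cvg _ (@continuous_cos R _)); exact: continuous_lin.
Qed.

Let continuous_sinl (d : R) : continuous (fun s => sin (d * th s)).
Proof.
by move=> s; apply: (continuous_cvg _ (@continuous_sin R _)); exact: continuous_lin.
Qed.

(** The primitive (N/d) sin(d theta), with d = 2j, tends to a multiple of sin(j pi) = 0 at both ends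
    theta = pi/2 and theta = -pi/2. The evenness of d reflects the spacing 2/N of the nodes. *)
Let integral_cos (j : int) : j != 0 -> \int[mu]_s (cos (2 * j%:~R * th s) * w s) = 0.
Proof.
move=> j0; set d : R := 2 * j%:~R.
have d0 : d != 0 by rewrite mulf_neq0// intr_eq0.
apply: (@FTC_line_cvg _ _ (fun s => (N / d) * sin (d * th s))).
- by move=> s; apply: continuousM; [exact: continuous_cosl|exact: continuous_w].
- move=> s.
  have dc := @is_derive1_comp _ sin (fun s => d * th s) s _ _
    (is_derive_sin (d * th s)) (is_derive_lin d s).
  refine (is_derive_eq (is_deriveZ (N / d) dc) _); rewrite /GRing.scale/=; field.
  by rewrite d0 gt_eqF.
- by apply: integrable_trig => // s; rewrite ler_norml cos_geN1 cos_le1.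
- rewrite (_ : (fun n : nat => _) =
      (fun n : nat => N / d * sin (d * th n.+1%:R) * 2)); last first.
    by apply/funext => n; rewrite thN mulrN sinN; ring.
  rewrite (_ : 0 = N / d * sin (d * (pi / 2)) * 2); last first.
    by rewrite /d (_ : 2 * _ * _ = j%:~R * pi); [rewrite sin_intpi mulr0 mul0r|field].
  apply: cvgM; last exact: cvg_cst.
  apply: cvgM; first exact: cvg_cst.
  apply: (continuous_cvg _ (@continuous_sin R _)).
  by apply: cvgM => //; exact: cvg_cst.
Qed.

(** The integrand is odd: its primitive, a cosine, takes equal values at opposite points, whatever d
    is. *)
Let integral_sin (d : R) : \int[mu]_s (sin (d * th s) * w s) = 0.
Proof.
have [->|d0] := eqVneq d 0.
  rewrite -[RHS](@Rintegral_set0 _ _ _ mu (fun=> 0)) /Rintegral.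
  under eq_integral do rewrite mul0r sin0 mul0r.
  by rewrite integral0 integral_set0.
apply: (@FTC_line_cvg _ _ (fun s => (- N / d) * cos (d * th s))).
- by move=> s; apply: continuousM; [exact: continuous_sinl|exact: continuous_w].
- move=> s.
  have dc := @is_derive1_comp _ cos (fun s => d * th s) s _ _
    (is_derive_cos (d * th s)) (is_derive_lin d s).
  refine (is_derive_eq (is_deriveZ (- N / d) dc) _); rewrite /GRing.scale/=; field.
  by rewrite d0 gt_eqF.
- by apply: integrable_trig => // s; rewrite ler_norml sin_geN1 sin_le1.
- under eq_fun do rewrite thN mulrN cosN subrr.
  exact: cvg_cst.
Qed.

(** The difference of two nodes is 2(k - l)/N, so eps drops out and N cancels; lambda only enters
    the phase of the power factor, which disappears in its squared modulus. *)
Let wave_conj lambda eps (k l : int) s :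
  wave lambda N (node eps N k) s * (wave lambda N (node eps N l) s)^*%C =
  cexp (0 +i* (2 * (k - l)%:~R * th s)) * (w s)%:C.
Proof.
(* At frequency 0 the wave is its power factor alone, so [w] becomes the product of that factor with
   its conjugate. *)
rewrite /w -(sqr_normc_wave lambda N 0) -mulcJ /wave mul0r.
rewrite (_ : cexp (0 +i* 0) = 1) ?mul1r; last exact: cexp0.
rewrite (conjcM (cexp _) (cpow _ _)) mulrACA; congr (_ * _).
rewrite cexp_conj -cexpD; congr cexp; simpc; congr (_ +i* _).
by rewrite -mulrBl mulrA; congr (_ * _); rewrite /node intrD mulrNz; field; rewrite gt_eqF.
Qed.

Lemma inL2_wave lambda y : inL2 (wave lambda N y).
Proof.
apply: integrable_inL2; first exact: cmeasurable_wave.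
rewrite (_ : (fun t => _) = w); first exact: integrable_weight.
by apply/funext => s; rewrite sqr_normc_wave.
Qed.

Lemma inner_wave_node lambda eps (k l : int) :
  inner (wave lambda N (node eps N k)) (wave lambda N (node eps N l)) =
  (N * pi)%:C *+ (k == l).
Proof.
rewrite /inner; under eq_fun do rewrite wave_conj.
rewrite /cintegral.
have -> : (fun s => cRe (cexp (0 +i* (2 * (k - l)%:~R * th s)) * (w s)%:C)) =
          (fun s => cos (2 * (k - l)%:~R * th s) * w s).
  by apply/funext => s; rewrite /cexp /= expR0 !(mul1r, mulr0, mul0r, subr0).
have -> : (fun s => cIm (cexp (0 +i* (2 * (k - l)%:~R * th s)) * (w s)%:C)) =
          (fun s => sin (2 * (k - l)%:~R * th s) * w s).
  by apply/funext => s; rewrite /cexp /= expR0 !(mul1r, mulr0, mul0r, subr0, addr0, add0r).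
rewrite integral_sin; have [->|kl] := eqVneq k l.
  rewrite subrr mulr0; under eq_Rintegral do rewrite mul0r cos0 mul1r.
  by rewrite integral_weight.
by rewrite integral_cos// subr_eq0.
Qed.

End Orthogonality.

Section L2more.
Context {R : realType}.
Import Normc.
Local Notation mu := (@lebesgue_measure R).
Implicit Types f g : R -> R[i].

Lemma inL2Z (z : R[i]) f : inL2 f -> inL2 (fun t => z * f t).
Proof.
move=> f2; have mf : cmeasurable f by case: f2.
apply: integrable_inL2; first exact: cmeasurableM (cmeasurable_cst z) mf.
have := integrableZl measurableT (normc z ^+ 2) (inL2_integrable f2).
by congr (_.-integrable _ _); apply/funext => t /=; rewrite normcM exprMn.
Qed.

Lemma inL2_0 : inL2 (fun=> 0 : R[i]).
Proof.
apply: integrable_inL2; first exact: cmeasurable_cst.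
rewrite (_ : EFin \o _ = cst 0%E); first exact: integrable0.
by apply/funext => t; rewrite /comp normc0 expr0n.
Qed.

Lemma inL2_sum (I : Type) (s : seq I) (F : I -> R -> R[i]) :
  (forall i, inL2 (F i)) -> inL2 (fun t => \sum_(i <- s) F i t).
Proof.
move=> iF; elim: s => [|a s ih].
  by under eq_fun do rewrite big_nil; exact: inL2_0.
by under eq_fun do rewrite big_cons; exact: inL2D.
Qed.

End L2more.

(** * The vector h_x as a rescaled Riemann sum of waves *)

Section Kernel.
Context {R : realType}.
Import Normc.
Local Notation mu := (@lebesgue_measure R).
Variables (lambda eps : R) (h : R -> R[i]).

(* h_x in the coordinate s = x^2 t, with N = x^2 (see [h_wavesum]). *)
Definition wavesum (N s : R) : R[i] :=
  ((Num.sqrt (2 * pi))^-1)%:C * ((2 / N)%:C *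
    \sum_(k \in [set: int]) h (node eps N k) * wave lambda N (node eps N k) s).

(** The factor exp(i pi m) cancels the exp(- i pi m) of the basis vector. The constant sqrt(2/pi) is
    x^2 times (2 pi)^(-1/2) times 2/x^2: the Jacobian of s = x^2 t, the constant of the Fourier
    transform, and the mesh. *)
Lemma h_wavesum x t : 0 < x ->
  h_ lambda eps h x t =
  (x ^+ 2)%:C / cpow x (1 +i* (2 * lambda)) * wavesum (x ^+ 2) (x ^+ 2 * t).
Proof.
move=> x0; have x20 : x ^+ 2 != 0 by rewrite expf_neq0// gt_eqF.
rewrite /h_ /wavesum.
have -> : \sum_(k \in [set: int]) (let m := eps + k%:~R in
      cexp (0 +i* (pi * m)) * h (2 * m / x ^+ 2) * basis_e lambda m t) =
    ((Num.sqrt pi)^-1)%:C *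
    \sum_(k \in [set: int]) h (node eps (x ^+ 2) k) *
       wave lambda (x ^+ 2) (node eps (x ^+ 2) k) (x ^+ 2 * t).
  rewrite mulr_fsumr; apply: eq_fsbigr => k _ /=; rewrite /basis_e /wave.
  rewrite [x ^+ 2 * t]mulrC mulfK// -/(node eps (x ^+ 2) k).
  rewrite (_ : node eps (x ^+ 2) k * (x ^+ 2 * atan t) =
    2 * (eps + k%:~R) * atan t); last first.
    by rewrite /node mulrA divfK.
  have e1 : cexp (0 +i* (pi * (eps + k%:~R))) * cexp (0 -i* (pi * (eps + k%:~R))) = 1 :> R[i].
    by rewrite -cexpD; simpc; exact: cexp0.
  set a := cexp _ in e1 *; set b := cexp _ in e1 *; set c := cexp _; set d := cpow _ _.
  set s := (_ ^-1)%:C; set hk := h _.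
  transitivity (a * b * (s * (hk * (c * d)))); first ring.
  by rewrite e1 mul1r.
have p0 : 0 < pi :> R by exact: pi_gt0.
have s2 : Num.sqrt 2 ^+ 2 = 2 :> R by rewrite sqr_sqrtr.
have sp : Num.sqrt pi ^+ 2 = pi :> R by rewrite sqr_sqrtr// ltW.
have s20 : Num.sqrt 2 != 0 :> R by rewrite sqrtr_eq0 -ltNge.
have sp0 : Num.sqrt pi != 0 :> R by rewrite sqrtr_eq0 -ltNge.
set S := (\sum_(k \in _) _).
have e : (Num.sqrt 2)%:C * ((Num.sqrt pi)^-1)%:C =
   (x ^+ 2)%:C * (((Num.sqrt (2 * pi))^-1)%:C * (2 / x ^+ 2)%:C) :> R[i].
  rewrite -!rmorphM/=; congr (_%:C); rewrite sqrtrM//.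
  by rewrite -[X in (X / x ^+ 2)]s2; field; rewrite ?s20 ?sp0 ?(gt_eqF x0).
transitivity ((Num.sqrt 2)%:C * ((Num.sqrt pi)^-1)%:C * (cpow x (1 +i* (2 * lambda)))^-1 * S).
  ring.
rewrite e; ring.
Qed.

(** The conjugate of x^(1 + 2 i lambda) is x^(-2 ell), which cancels the factor of the dilation; the
    remaining x^2 is absorbed by the substitution s = x^2 t. *)
Lemma inner_dilation_h (g : R -> R[i]) (x : R) : 0 < x -> inL2 g -> inL2 (wavesum (x ^+ 2)) ->
  inner (dilation lambda x g) (h_ lambda eps h x) = inner g (wavesum (x ^+ 2)).
Proof.
move=> x0 g2 K2; have x20 : 0 < x ^+ 2 by rewrite exprn_gt0.
pose G s := g s * (wavesum (x ^+ 2) s)^*%C.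
have iG : cintegrable G by exact: inner_integrable.
have -> : inner (dilation lambda x g) (h_ lambda eps h x) =
          cintegral (fun t => (x ^+ 2)%:C * G (x ^+ 2 * t)).
  rewrite /inner; congr cintegral; apply/funext => t.
  rewrite h_wavesum// /dilation /G (conjcM (_ / _) (wavesum _ _)).
  rewrite (conjcM (x ^+ 2)%:C) conjc_inv conjc_real.
  rewrite (_ : ((cpow x (1 +i* (2 * lambda)))^*)%C = cpow x (- 2 * ell lambda)); last first.
    rewrite /cpow cexp_conj; congr cexp; rewrite /ell; simpc.
    by congr (_ +i* _); field.
  have := cexp_neq0 (- 2 * ell lambda * (ln x)%:C); rewrite -/(cpow x _).
  set c := cpow _ _ => c0; set gt := g _; set kt := (wavesum _ _)^*%C.
  by field.
rewrite cintegralZ; last exact: (cintegrable_scale x20 iG).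
rewrite (cintegral_scale x20 iG) mulrA -rmorphM/= divff ?mul1r//.
by rewrite gt_eqF.
Qed.

End Kernel.

(** * Limits of the rescaled sums *)

Section CompactSupport.
Context {R : realType}.
Import Normc.
Local Notation mu := (@lebesgue_measure R).

Definition Cc (h : R -> R[i]) := continuous (h : R -> R[i]^o) /\
  exists M : R, forall y, M < `|y| -> h y = 0.

Lemma Cc_of_compact (h : R -> R[i]) : continuous (h : R -> R[i]^o) ->
  compact (closure [set y : R | h y != 0]) -> Cc h.
Proof.
move=> ch /compact_bounded [M [_ hM]]; split => //; exists (M + 1) => y My.
apply/eqP; apply: contraTT My => hy; rewrite -leNgt.
by apply: (hM (M + 1)); [rewrite ltrDl|exact: subset_closure].
Qed.

Lemma node_support (f : R -> R[i]) (M eps N : R) : 0 < N -> (forall y, M < `|y| -> f y = 0) ->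
  exists B, forall k, k \notin zrange B -> f (node eps N k) = 0.
Proof.
move=> N0 hM.
have a0 : 0 <= `|M| * N / 2 + `|eps| by rewrite addr_ge0// divr_ge0// mulr_ge0// ltW.
(* If |2 (eps + k) / N| <= |M| then |k| <= |M| N / 2 + |eps|. *)
exists (Num.bound (`|M| * N / 2 + `|eps|)) => k.
rewrite mem_zrange -ltNge => kB; apply: hM.
have h1 := archi_boundP a0.
have h2 : (Num.bound (`|M| * N / 2 + `|eps|))%:R < `|k%:~R| :> R.
  by rewrite -intr_norm -[_%:R]/(_%:Z%:~R) ltr_int.
have h3 : `|M| * N / 2 < `|eps + k%:~R|.
  have := ler_normD (eps + k%:~R) (- eps); rewrite normrN addrAC subrr add0r.
  lra.
rewrite /node normrM normfV (gtr0_norm N0) ltr_pdivlMr// normrM (@gtr0_norm _ 2)//.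
apply: (@le_lt_trans _ _ (`|M| * N)); first by rewrite ler_pM2r// ler_norm.
lra.
Qed.

Variable h : R -> R[i].
Hypothesis hC : Cc h.

Lemma Cc_bounded : exists H : R, 0 <= H /\ forall y, normc (h y) <= H.
Proof.
have [ch [M hM]] := hC.
have cn : continuous (fun y => normc (h y)).
  by move=> y; apply: cvg_normc; exact: ch.
(* A negative M forces h = 0; otherwise the maximum is attained on [-M, M]. *)
have [M0|M0] := ltP M 0.
  exists 0; split => // y; rewrite hM ?normc0//.
  exact: lt_le_trans M0 _.
have [c _ cM] := @EVT_max R (fun y => normc (h y)) (- M) M (ge0_cp M0).2
  (continuous_subspaceT cn).
exists (normc (h c)); split; first exact: normc_ge0.
move=> y; have [yM|yM] := leP `|y| M.
  by apply: cM; rewrite in_itv/= -ler_norml.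
by rewrite hM// normc0 normc_ge0.
Qed.

Lemma Cc_cmeasurable : cmeasurable h.
Proof.
have [ch _] := hC; split; apply: continuous_measurable_fun => y;
by have /cvg_complexP[] := ch y.
Qed.

Lemma integrable_indic_sym (M : R) (c : R) :
  mu.-integrable setT (EFin \o (fun y : R => c * \1_(`[- M, M]%classic : set R) y)).
Proof.
exact: (integrableZl measurableT c (integrable_indic_itv _ _ _ _)).
Qed.

Lemma Cc_inL2 : inL2 h.
Proof.
have [H [H0 hH]] := Cc_bounded; have [_ [M hM]] := hC.
apply: integrable_inL2; first exact: Cc_cmeasurable.
have := integrable_indic_sym M (H ^+ 2); apply: le_integrable => //.
  by apply: measurable_sqn; exact: Cc_cmeasurable.
move=> y _ /=; rewrite lee_fin ger0_norm ?sqr_ge0// indicE; have [yM|yM] := leP `|y| M.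
  rewrite mem_set/=; last by rewrite in_itv/= -ler_norml.
  by rewrite mulr1 ger0_norm ?sqr_ge0// ler_sqr ?nnegrE ?normc_ge0.
by rewrite hM// normc0 expr0n/= normr_ge0.
Qed.

End CompactSupport.

(** * Inner products and norms of the sums as N grows *)

Section KernelLimits.
Context {R : realType}.
Import Normc.
Local Notation mu := (@lebesgue_measure R).
Variables (lambda eps : R) (h : R -> R[i]).
Hypothesis hC : Cc h.
Local Notation wavesum := (wavesum lambda eps h).

Lemma wavesum_finite N : 0 < N ->
  exists B, (forall k, k \notin zrange B -> h (node eps N k) = 0) /\
  wavesum N = fun s => ((Num.sqrt (2 * pi))^-1)%:C * ((2 / N)%:C *
    \sum_(k <- zrange B) h (node eps N k) * wave lambda N (node eps N k) s).
Proof.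
move=> N0; have [_ [M hM]] := hC; have [B hB] := node_support eps N0 hM; exists B; split => //.
apply/funext => s; rewrite /wavesum (@fsbig_zrange _ B)// => k /hB ->.
by rewrite mul0r.
Qed.

Lemma inL2_wavesum N : 0 < N -> inL2 (wavesum N).
Proof.
move=> N0; have [B [_ ->]] := wavesum_finite N0.
do 2 apply: inL2Z; apply: inL2_sum => k; apply: inL2Z; exact: inL2_wave.
Qed.

(** The analogue at finite N of the Fourier integral of f at y, without the factor (2 pi)^(-1/2). *)
Definition wave_coef (f : R -> R[i]) N y := cintegral (fun s => f s * (wave lambda N y s)^*%C).

Let integrable_wave_coef f N y : cintegrable f ->
  cintegrable (fun s => f s * (wave lambda N y s)^*%C).
Proof.
move=> fi; apply: (@cintegrable_le _ _ (fun s => normc (f s))).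
- apply: cmeasurableM; first exact: cintegrable_meas.
  by apply: cmeasurable_conj; exact: cmeasurable_wave.
- exact: cintegrable_normc.
- by move=> t; rewrite normcM normc_conj ler_piMr ?normc_ge0 ?normc_wave_le1.
Qed.

Lemma normc_wave_coef f N y : cintegrable f ->
  normc (wave_coef f N y) <= 2 * \int[mu]_s normc (f s).
Proof.
move=> fi; apply: le_normc_cintegral.
- exact: cintegrable_meas (integrable_wave_coef _ _ fi).
- exact: cintegrable_normc.
- by move=> t; rewrite normcM normc_conj ler_piMr ?normc_ge0 ?normc_wave_le1.
Qed.

(** The compact support of h makes the sum finite, so linearity exchanges it with the integral over
    s; the mesh 2/N then becomes the length of the cells in y. *)
Lemma inner_wavesum f N : 0 < N -> cintegrable f ->
  inner f (wavesum N) = cintegral (fun y => let y' := node eps N (gridi eps N y) in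
    ((Num.sqrt (2 * pi))^-1)%:C * wave_coef f N y' * (h y')^*%C).
Proof.
move=> N0 fi; have [B [hB KB]] := wavesum_finite N0.
pose phi k := ((Num.sqrt (2 * pi))^-1)%:C *
  wave_coef f N (node eps N k) * (h (node eps N k))^*%C.
have phi0 k : k \notin zrange B -> phi k = 0.
  by move=> /hB; rewrite /phi => ->; rewrite conjc0 mulr0.
rewrite (@cintegral_step _ eps N B phi)// (fsbig_zrange phi0).
have iF k : cintegrable (fun s =>
    (h (node eps N k))^*%C * (f s * (wave lambda N (node eps N k) s)^*%C)).
  by apply: cintegrableZ; exact: integrable_wave_coef.
have e : (fun s => f s * (wavesum N s)^*%C) =
    (fun s => ((Num.sqrt (2 * pi))^-1)%:C * ((2 / N)%:C * \sum_(k <- zrange B)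
      (h (node eps N k))^*%C * (f s * (wave lambda N (node eps N k) s)^*%C))).
  apply/funext => s; rewrite KB (conjcM _%:C) (conjcM _%:C) !conjc_real.
  rewrite mulrCA; congr (_ * _); rewrite mulrCA; congr (_ * _).
  rewrite conjc_sum mulr_sumr; apply: eq_bigr => k _.
  by rewrite (conjcM (h _)) mulrCA.
rewrite /inner e cintegralZ; last by apply: cintegrableZ; apply: cintegrable_sum.
rewrite cintegralZ; last exact: cintegrable_sum.
rewrite mulrCA; congr (_ * _); rewrite cintegral_sum// mulr_sumr; apply: eq_bigr => k _.
rewrite cintegralZ; last exact: integrable_wave_coef.
by rewrite /phi /wave_coef; ring.
Qed.

Variable N : nat -> R.
Hypotheses (N1 : forall n, 1 <= N n) (Noo : N n @[n --> \oo] --> +oo).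

Let N0 n : 0 < N n.
Proof. exact: lt_le_trans (N1 n). Qed.

(* [phi n] is sampled on the grid of mesh 2 / N n, so that dominated convergence
   replaces any estimate of the error of the Riemann sums. *)
Lemma cvg_step (phi : nat -> R -> R[i]^o) (psi : R -> R[i]^o) (C M : R) :
  (forall n y, M < `|y| -> phi n y = 0) -> (forall n y, normc (phi n y) <= C) ->
  (forall y, phi n (node eps (N n) (gridi eps (N n) y)) @[n --> \oo] --> psi y) ->
  (cintegral (fun y => phi n (node eps (N n) (gridi eps (N n) y))) : R[i]^o) @[n --> \oo] -->
  (cintegral psi : R[i]^o).
Proof.
move=> hM hC' hpsi.
have C0 : 0 <= C by apply: le_trans (hC' 0%N 0); exact: normc_ge0.
(* As N >= 1 a node lies within 2 of every point of its cell, so all the step functions vanish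
   outside [-(M + 2), M + 2]. *)
have [||||_] := @cintegral_dominated _
  (fun n y => phi n (node eps (N n) (gridi eps (N n) y))) psi
  (fun y => C * \1_(`[- (M + 2), M + 2]%classic : set R) y).
- move=> n; have [B hB] := node_support eps (N0 n) (hM n).
  apply: cintegrable_meas.
  exact: (@cintegrable_step _ eps _ B (fun k => phi n (node eps (N n) k)) (N0 n) hB).
- exact: hpsi.
- exact: integrable_indic_sym.
- move=> n y; rewrite indicE; have [yM|yM] := leP `|y| (M + 2).
    by rewrite mem_set/= ?mulr1// in_itv/= -ler_norml.
  rewrite hM ?normc0 ?mulr_ge0//.
  have h1 := gridi_dist eps y (N0 n).
  have h2 : 2 / N n <= 2 by rewrite ler_pdivrMr// ler_peMr.
  have := ler_distD (node eps (N n) (gridi eps (N n) y)) y 0; rewrite !subr0; lra.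
- exact.
Qed.

Let node_cvg y : node eps (N n) (gridi eps (N n) y) @[n --> \oo] --> y.
Proof. exact: cvg_node_gridi. Qed.

Let h_cvg y :
  (h (node eps (N n) (gridi eps (N n) y)) : R[i]^o) @[n --> \oo] --> (h y : R[i]^o).
Proof. by have [ch _] := hC; apply: cvg_comp; [exact: node_cvg|exact: ch]. Qed.

Lemma cvg_inner_wavesum f : cintegrable f ->
  (inner f (wavesum (N n)) : R[i]^o) @[n --> \oo] --> (inner (fourierL1 f) h : R[i]^o).
Proof.
move=> fi; under eq_fun do rewrite inner_wavesum//.
have [H [H0 hH]] := Cc_bounded hC; have [_ [M hM]] := hC.
have cvg_coef y :
    (wave_coef f (N n) (node eps (N n) (gridi eps (N n) y)) : R[i]^o) @[n --> \oo] -->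
    (cintegral (fun s => f s * cexp (0 -i* (y * s))) : R[i]^o).
  have [||||_] := @cintegral_dominated _
    (fun n s => f s * (wave lambda (N n) (node eps (N n) (gridi eps (N n) y)) s)^*%C)
    (fun s => f s * cexp (0 -i* (y * s))) (fun s => normc (f s)).
  - by move=> n; apply: cintegrable_meas; exact: integrable_wave_coef.
  - move=> s; apply: cvgM; first exact: cvg_cst.
    rewrite (_ : cexp _ = (cexp (0 +i* (y * s)))^*%C); last by rewrite cexp_conj.
    by apply: cvg_conjc; exact: cvg_wave.
  - exact: cintegrable_normc.
  - by move=> n t; rewrite normcM normc_conj ler_piMr ?normc_ge0 ?normc_wave_le1.
  - exact.
rewrite /inner /fourierL1.
have -> : (fun y => ((Num.sqrt (2 * pi))^-1)%:C *
      cintegral (fun t => cexp (0 -i* (t * y)) * f t) * (h y)^*%C) =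
    (fun y => ((Num.sqrt (2 * pi))^-1)%:C *
      cintegral (fun s => f s * cexp (0 -i* (y * s))) * (h y)^*%C).
  apply/funext => y; congr (_ * _ * _); congr cintegral; apply/funext => t.
  by rewrite mulrC [y * t]mulrC.
set c := ((Num.sqrt (2 * pi))^-1)%:C.
apply: (@cvg_step (fun n y => c * wave_coef f (N n) y * (h y)^*%C) _
  (normc c * (2 * \int[mu]_s normc (f s)) * H) M).
- by move=> n y /hM ->; rewrite conjc0 mulr0.
- move=> n y; rewrite !normcM normc_conj ler_pM ?mulr_ge0 ?normc_ge0//.
  by rewrite ler_wpM2l ?normc_ge0// normc_wave_coef.
- move=> y; apply: cvgM; last by apply: cvg_conjc.
  by apply: cvgM; [exact: cvg_cst|exact: cvg_coef].
Qed.

(** Orthogonality leaves only the diagonal of the double sum, and (2 pi)^(-1) (2/N)^2 times N pi is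
    2/N, the length of a cell. *)
Lemma inner_wavesum_self n : inner (wavesum (N n)) (wavesum (N n)) =
  cintegral (fun y => (normc (h (node eps (N n) (gridi eps (N n) y))) ^+ 2)%:C).
Proof.
have [B [hB KB]] := wavesum_finite (N0 n).
pose phi k := (normc (h (node eps (N n) k)) ^+ 2)%:C : R[i].
have phi0 k : k \notin zrange B -> phi k = 0.
  by move=> /hB; rewrite /phi => ->; rewrite normc0 expr0n.
rewrite (@cintegral_step _ eps (N n) B phi)// (fsbig_zrange phi0).
set c : R[i] := ((Num.sqrt (2 * pi))^-1)%:C; set d : R[i] := (2 / N n)%:C.
pose e k := wave lambda (N n) (node eps (N n) k); pose a k := h (node eps (N n) k).
have ie k l (z : R[i]) : cintegrable (fun s => z * (e k s * (e l s)^*%C)).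
  by apply: cintegrableZ; apply: inner_integrable; exact: inL2_wave.
have eq : (fun s => wavesum (N n) s * (wavesum (N n) s)^*%C) = (fun s => (c * d) ^+ 2 *
   \sum_(k <- zrange B) \sum_(l <- zrange B) (a k * (a l)^*%C) * (e k s * (e l s)^*%C)).
  apply/funext => s; rewrite KB -/c -/d (conjcM c) (conjcM d) !conjc_real -/c -/d.
  rewrite [X in _ = _ * X](_ : _ = (\sum_(k <- zrange B) a k * e k s) *
     (\sum_(k <- zrange B) a k * e k s)^*%C); first by rewrite /a /e; ring.
  rewrite conjc_sum mulr_suml; apply: eq_bigr => k _.
  by rewrite mulr_sumr; apply: eq_bigr => l _; rewrite (conjcM (a l)); rewrite mulrACA.
rewrite /inner eq cintegralZ; last by do 2 (apply: cintegrable_sum => ?); exact: ie.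
rewrite cintegral_sum; last by move=> k; apply: cintegrable_sum => l; exact: ie.
rewrite !mulr_sumr; apply: eq_big_seq => k kB.
rewrite cintegral_sum// (bigD1_seq _ kB (zrange_uniq B)) big1 ?Monoid.mulm1; last first.
  move=> l kl; rewrite cintegralZ; last by apply: inner_integrable; exact: inL2_wave.
  by rewrite -/(inner (e k) (e l)) inner_wave_node// eq_sym (negbTE kl) mulr0n mulr0.
rewrite cintegralZ; last by apply: inner_integrable; exact: inL2_wave.
rewrite -/(inner (e k) (e k)) inner_wave_node// eqxx mulr1n mulcJ mulrCA mulrC; congr (_ * _).
rewrite /c /d -!rmorphM -rmorphXn -rmorphM/=; congr (_%:C).
have p0 : 0 < pi :> R by exact: pi_gt0.
have sp : Num.sqrt (2 * pi) ^+ 2 = 2 * pi :> R by rewrite sqr_sqrtr// mulr_ge0// ltW.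
rewrite exprMn exprVn sp; move: (pi : R) p0 {sp} => p p0; field.
by rewrite !gt_eqF ?N0 ?p0.
Qed.

Lemma cvg_sqn_wavesum : fine (sqn (wavesum (N n))) @[n --> \oo] --> fine (sqn h).
Proof.
have [H [H0 hH]] := Cc_bounded hC; have [_ [M hM]] := hC.
have e n : fine (sqn (wavesum (N n))) = cRe (inner (wavesum (N n)) (wavesum (N n))).
  by rewrite inner_self//; exact: inL2_wavesum.
have -> : fine (sqn h) = cRe (inner h h) by rewrite inner_self//; exact: Cc_inL2.
under eq_fun do rewrite e inner_wavesum_self.
suff /cvg_complexP[] :
    (cintegral (fun y => (normc (h (node eps (N n) (gridi eps (N n) y))) ^+ 2)%:C) : R[i]^o)
    @[n --> \oo] --> (inner h h : R[i]^o) by [].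
have -> : inner h h = cintegral (fun y => (normc (h y) ^+ 2)%:C).
  by congr cintegral; apply/funext => y; rewrite mulcJ.
apply: (@cvg_step (fun n y => (normc (h y) ^+ 2)%:C) _ (H ^+ 2) M).
- by move=> n y /hM ->; rewrite normc0 expr0n.
- by move=> n y; rewrite normc_real ger0_norm ?sqr_ge0// ler_sqr ?nnegrE ?normc_ge0.
- move=> y; under eq_fun do rewrite -mulcJ.
  by rewrite -mulcJ; apply: cvgM => //; exact: cvg_conjc.
Qed.

End KernelLimits.

(** * The Fourier transform on L1 and L2 *)

Section Fatou.
Context {R : realType}.
Import Normc.
Local Notation mu := (@lebesgue_measure R).

(** Lets a norm bound survive a limit that is only almost everywhere: for cutoffs exhausting a
    transform, and for the distance to the limit of a fast Cauchy sequence. *)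
Lemma sqn_fatou (f_ : nat -> R -> R[i]^o) (f : R -> R[i]^o) (C : \bar R) :
  (forall n, cmeasurable (f_ n)) -> cmeasurable f ->
  {ae mu, forall t, f_ n t @[n --> \oo] --> f t} ->
  (forall n, (sqn (f_ n) <= C)%E) -> (sqn f <= C)%E.
Proof.
move=> mf_ mf ff fC.
have mfn n := measurable_sqn (mf_ n).
(* The lower limit is measurable because it is the opposite of the upper limit of the opposites. *)
have msup : measurable_fun setT (fun t => limn_esup (fun n => - ((normc (f_ n t)) ^+ 2)%:E)%E).
  by apply: measurable_fun_limn_esup => n; exact: measurableT_comp.
have e t : limn_einf (fun n => ((normc (f_ n t)) ^+ 2)%:E) =
    (- limn_esup (fun n => - ((normc (f_ n t)) ^+ 2)%:E))%E.
  by rewrite -[RHS]limn_einfN; congr limn_einf; apply/funext => n /=; rewrite opprK.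
have -> : sqn f = (\int[mu]_t limn_einf (fun n => ((normc (f_ n t)) ^+ 2)%:E))%E.
  apply: ae_eq_integral => //.
  - exact: measurable_sqn.
  - by under eq_fun do rewrite e; exact: measurableT_comp.
  - have FF := ae_filter_ringOfSetsType mu; apply: (@filterS _ _ FF _ _ _ ff) => t ft _.
    have cv : ((normc (f_ n t)) ^+ 2)%:E @[n --> \oo] --> ((normc (f t)) ^+ 2)%:E.
      apply: cvg_EFin; first exact: nearW.
      by rewrite /comp/= !expr2; under eq_fun do rewrite expr2; apply: cvgM; exact: cvg_normc.
    by rewrite (cvg_limn_einf_sup cv).1.
apply: le_trans (@fatou _ _ _ mu _ measurableT _ mfn _) _.
  by move=> n t _; rewrite lee_fin sqr_ge0.
rewrite limn_einf_lim; apply: lime_le; first exact: is_cvg_einfs.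
apply: nearW => n; apply: le_trans (fC n).
by apply: ereal_inf_lbound; exists n => /=.
Qed.

End Fatou.

(** * Continuity and norm bound for the transform of an integrable function *)

Section FourierL1.
Context {R : realType}.
Import Normc.
Local Notation mu := (@lebesgue_measure R).
Implicit Types f : R -> R[i].

Lemma normc_cis (x : R) : normc (cexp (0 +i* x)) = 1.
Proof. by rewrite normc_cexp expR0. Qed.

Lemma cmeasurable_cis (y : R) : cmeasurable (fun t : R => cexp (0 -i* (t * y))).
Proof.
apply: cmeasurable_cexp; split => /=; first exact: measurable_cst.
by apply: measurableT_comp => //; exact: mulrr_measurable.
Qed.

Lemma cintegrable_cis f y : cintegrable f -> cintegrable (fun t => cexp (0 -i* (t * y)) * f t).
Proof.
move=> fi; apply: (@cintegrable_le _ _ (fun s => normc (f s))).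
- by apply: cmeasurableM; [exact: cmeasurable_cis|exact: cintegrable_meas].
- exact: cintegrable_normc.
- by move=> t; rewrite normcM normc_cis mul1r.
Qed.

Lemma fourierL1B f g : cintegrable f -> cintegrable g ->
  fourierL1 (fun t => f t - g t) = (fun y => fourierL1 f y - fourierL1 g y).
Proof.
move=> fi gi; apply/funext => y; rewrite /fourierL1 -mulrBr; congr (_ * _).
have i1 := cintegrable_cis y fi.
have i2 := cintegrableZ (-1) (cintegrable_cis y gi).
rewrite -[X in _ = _ + X]mulN1r -cintegralZ; last exact: cintegrable_cis.
rewrite -cintegralD//; congr cintegral; apply/funext => t.
by rewrite mulrBr mulN1r.
Qed.

(** Dominated convergence by |f|, hence along sequences. Continuity makes a cutoff of the transform
    an admissible h. *)
Lemma continuous_fourierL1 f : cintegrable f -> continuous (fourierL1 f : R -> R[i]^o).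
Proof.
move=> fi y.
have seq_c (u : nat -> R) : u n @[n --> \oo] --> y ->
    (fourierL1 f (u n) : R[i]^o) @[n --> \oo] --> (fourierL1 f y : R[i]^o).
  move=> uy; rewrite /fourierL1; apply: cvgM; first exact: cvg_cst.
  have [||||_] := @cintegral_dominated _ (fun n t => cexp (0 -i* (t * u n)) * f t)
    (fun t => cexp (0 -i* (t * y)) * f t) (fun t => normc (f t)).
  - by move=> n; exact: cintegrable_meas (cintegrable_cis _ fi).
  - move=> t; apply: cvgM; last exact: cvg_cst.
    apply: cvg_cexp; apply/cvg_complexP; split => /=; first exact: cvg_cst.
    by apply: cvgN; apply: cvgM => //; exact: cvg_cst.
  - exact: cintegrable_normc.
  - by move=> n t; rewrite normcM normc_cis mul1r.
  - exact.
apply/cvg_complexP; split.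
- by apply/(@cvg_nbhsP _ R^o) => u /seq_c /cvg_complexP[].
- by apply/(@cvg_nbhsP _ R^o) => u /seq_c /cvg_complexP[].
Qed.

Lemma cmeasurable_fourierL1 f : cintegrable f -> cmeasurable (fourierL1 f).
Proof.
move=> fi; have c := continuous_fourierL1 fi.
by split; apply: continuous_measurable_fun => y; have /cvg_complexP[] := c y.
Qed.

(** The trapezoid equal to 1 for |y| <= n, to n + 1 - |y| in between, and to 0 for |y| >= n + 1;
    absolute values give it by one visibly continuous formula. *)
Definition cutoff (n : nat) (y : R) : R := (1 + `|n%:R + 1 - `|y| | - `|n%:R - `|y| |) / 2.

Lemma cutoff_itv n y : 0 <= cutoff n y <= 1.
Proof.
rewrite /cutoff; move: (n%:R - `|y|) (n%:R + 1 - `|y|) (addrAC (n%:R : R) 1 (- `|y|)) => a b ->.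
have := ler_normD a 1; have := ler_normD (a + 1) (-1); rewrite addrK normrN normr1; lra.
Qed.

Lemma cutoff0 n y : n.+1%:R < `|y| -> cutoff n y = 0.
Proof.
rewrite -natr1 => ny; rewrite /cutoff (@ltr0_norm _ (_ + 1 - _)); last lra.
by rewrite (@ltr0_norm _ (n%:R - _)); [field|lra].
Qed.

Lemma cutoff1 n y : `|y| <= n%:R -> cutoff n y = 1.
Proof.
move=> ny; rewrite /cutoff (@ger0_norm _ (_ + 1 - _)); last lra.
by rewrite (@ger0_norm _ (n%:R - _)); [field|lra].
Qed.

Lemma cvg_cutoff y : cutoff n y @[n --> \oo] --> (1 : R).
Proof.
apply: cvg_near_cst; near=> n; apply: cutoff1.
by near: n; exact: nbhs_infty_ger.
Unshelve. all: by end_near. Qed.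

Lemma continuous_cutoff n : continuous (cutoff n).
Proof.
move=> y; have cn (a : R) : (fun y : R => `|a - `|y| |) @ y --> `|a - `|y| |.
  by apply: cvg_norm; apply: cvgB; [exact: cvg_cst|exact: norm_continuous].
apply: cvgM; last exact: cvg_cst.
by apply: cvgB => //; apply: cvgD => //; exact: cvg_cst.
Qed.

(* By duality: for h a cutoff of the transform itself, the inequality
   Re (f | wavesum N) <= (|f|^2 + |wavesum N|^2) / 2 passes to the limit. *)
Lemma sqn_fourierL1_le f : cintegrable f -> inL2 f -> (sqn (fourierL1 f) <= sqn f)%E.
Proof.
move=> fi f2; set fh := fourierL1 f.
pose h n y : R[i] := (cutoff n y)%:C * fh y.
have hC n : Cc (h n).
  split; last by exists n.+1%:R => y /cutoff0 cy; rewrite /h cy mul0r.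
  move=> y; apply: cvgM; last exact: continuous_fourierL1.
  by apply/cvg_complexP; split => /=; [exact: continuous_cutoff|exact: cvg_cst].
have mh n : cmeasurable (h n) by exact: Cc_cmeasurable.
apply: (@sqn_fatou _ h) => //.
- exact: cmeasurable_fourierL1.
- apply: aeW => y; rewrite -[X in _ --> X]mul1r; apply: cvgM; last exact: cvg_cst.
  by apply/cvg_complexP; split => /=; [exact: cvg_cutoff|exact: cvg_cst].
move=> n.
have h2 : inL2 (h n) by exact: Cc_inL2.
(* Any sequence above 1 tending to infinity serves; the parameters lambda and eps, absent from the
   limits, are set to 0. *)
pose N k : R := k.+1%:R.
have N1 k : 1 <= N k by rewrite ler1n.
have Noo : N k @[k --> \oo] --> +oo.
  apply/cvgryPge => A; near=> k; rewrite (@le_trans _ _ k%:R)//; last by rewrite ler_nat.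
  by near: k; exact: nbhs_infty_ger.
have K2 k : inL2 (wavesum 0 0 (h n) (N k)).
  by apply: inL2_wavesum => //; exact: lt_le_trans (N1 k).
have c1 := cvg_inner_wavesum 0 0 (hC n) N1 Noo fi.
have /cvg_complexP[c1' _] := c1.
have c2 := cvg_sqn_wavesum 0 0 (hC n) N1 Noo.
have le1 : cRe (inner fh (h n)) <= 2^-1 * (fine (sqn f) + fine (sqn (h n))).
  have c3 : 2^-1 * (fine (sqn f) + fine (sqn (wavesum 0 0 (h n) (N k)))) @[k --> \oo] -->
      2^-1 * (fine (sqn f) + fine (sqn (h n))).
    by apply: cvgM; [exact: cvg_cst|apply: cvgD => //; exact: cvg_cst].
  apply: (ler_cvg_to c1' c3).
  by apply: nearW => k; exact: Re_inner_le.
have le2 : fine (sqn (h n)) <= cRe (inner fh (h n)).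
  have -> : fine (sqn (h n)) = cRe (inner (h n) (h n)) by rewrite inner_self.
  have hE y : h n y * (h n y)^*%C = (cutoff n y ^+ 2 * normc (fh y) ^+ 2)%:C.
    by rewrite mulcJ /h normcM normc_real ger0_norm ?(andP (cutoff_itv _ _)).1// exprMn.
  have fhE y : fh y * (h n y)^*%C = (cutoff n y * normc (fh y) ^+ 2)%:C.
    by rewrite /h (conjcM _%:C) conjc_real mulrCA mulcJ -rmorphM.
  have [i1 _] := inner_integrable h2 h2.
  have [i2 _] : cintegrable (fun y => fh y * (h n y)^*%C).
    (* The transform is not yet known to be in L^2; but the next cutoff equals 1 wherever [cutoff n]
       is nonzero, so the transform may be replaced by [h n.+1], which is. *)
    rewrite (_ : (fun _ => _) = (fun y => h n.+1 y * (h n y)^*%C)).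
      by apply: inner_integrable => //; exact: Cc_inL2.
    apply/funext => y; have [yn|yn] := leP `|y| n.+1%:R.
      by rewrite [in RHS]/h cutoff1// mul1r.
    by rewrite {1 3}/h cutoff0// mul0r conjc0 !mulr0.
  rewrite /inner; apply: le_Rintegral => // y _.
  rewrite hE fhE /= ler_wpM2r ?sqr_ge0//.
  by have /andP[c0 c1''] := cutoff_itv n y; rewrite expr2 ler_piMl.
(* From |h_n|^2 <= (|f|^2 + |h_n|^2) / 2, half of |h_n|^2 is moved to the left. *)
have : fine (sqn (h n)) <= fine (sqn f) by lra.
by rewrite -lee_fin !fineK// inL2_fin.
Unshelve. all: by end_near. Qed.

End FourierL1.

(** * Truncations: density of the integrable functions in L^2 *)

Section Truncation.
Context {R : realType}.
Import Normc.
Local Notation mu := (@lebesgue_measure R).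
Variable g : R -> R[i].
Hypothesis g2 : inL2 g.

Definition trunc (n : nat) (t : R) : R[i] := (\1_(`[- n%:R, n%:R]%classic : set R) t)%:C * g t.

Let mg : cmeasurable g.
Proof. by case: g2. Qed.

Let trunc_in n t : `|t| <= n%:R -> trunc n t = g t.
Proof. by move=> tn; rewrite /trunc indicE mem_set ?mul1r//= in_itv/= -ler_norml. Qed.

Let trunc_out n t : ~~ (`|t| <= n%:R) -> trunc n t = 0.
Proof.
move=> tn; rewrite /trunc indicE memNset ?mul0r//= in_itv/= -ler_norml; exact/negP.
Qed.

Let normc_trunc n t : normc (trunc n t) <= normc (g t).
Proof.
have [tn|tn] := boolP (`|t| <= n%:R); first by rewrite trunc_in.
by rewrite trunc_out// normc0 normc_ge0.
Qed.

Lemma cmeasurable_trunc n : cmeasurable (trunc n).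
Proof.
apply: cmeasurableM mg; split => /=; last exact: measurable_cst.
by apply: measurable_indic; exact: measurable_itv.
Qed.

Lemma inL2_trunc n : inL2 (trunc n).
Proof.
apply/inL2P; split; first exact: cmeasurable_trunc.
by apply: le_lt_trans (le_sqn (normc_trunc n) (cmeasurable_trunc n) mg) _; case/inL2P : g2.
Qed.

(** On a bounded interval L^2 is contained in L^1, because |g| <= |g|^2 + 1. *)
Lemma cintegrable_trunc n : cintegrable (trunc n).
Proof.
have i1 := inL2_integrable g2.
have i2 := integrable_indic_sym n%:R (1 : R).
apply: (@cintegrable_le _ _ (fun t => normc (g t) ^+ 2 +
   1 * \1_(`[- n%:R, n%:R]%classic : set R) t)).
- exact: cmeasurable_trunc.
- exact: (integrableD measurableT i1 i2).
- move=> t; rewrite mul1r indicE; have [tn|tn] := boolP (`|t| <= n%:R).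
    rewrite trunc_in// mem_set/=; last by rewrite in_itv/= -ler_norml.
    by have := sqr_ge0 (normc (g t) - 1); rewrite sqrrB1 mulr2n; have := normc_ge0 (g t); lra.
  by rewrite trunc_out// normc0 addr_ge0// sqr_ge0.
Qed.

Lemma cvg_sqn_trunc : sqn (fun t => trunc n t - g t) @[n --> \oo] --> 0%E.
Proof.
have [||||_] := @Rintegral_dominated R (fun n t => normc (trunc n t - g t) ^+ 2) (fun=> 0)
  (fun t => normc (g t) ^+ 2).
- move=> n; apply: measurable_funX; apply: measurable_normc.
  by apply: cmeasurableB => //; exact: cmeasurable_trunc.
- move=> t; apply: cvg_near_cst; near=> n; rewrite trunc_in ?subrr ?normc0 ?expr0n//.
  by near: n; exact: nbhs_infty_ger.
- exact: inL2_integrable.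
- move=> n t; rewrite ger0_norm ?sqr_ge0// ler_sqr ?nnegrE ?normc_ge0//.
  have [tn|tn] := boolP (`|t| <= n%:R); first by rewrite trunc_in// subrr normc0 normc_ge0.
  by rewrite trunc_out// sub0r normcN.
rewrite Rintegral_cst// mul0r => h.
apply/fine_cvgP; split; last exact: h.
apply: nearW => n; apply: inL2_fin; apply: inL2B => //; exact: inL2_trunc.
Unshelve. all: by end_near. Qed.

Lemma inL1_trunc n : inL1 (trunc n).
Proof. by apply/inL1P; exact: cintegrable_trunc. Qed.

End Truncation.

Section Plancherel.
Context {R : realType}.
Import Normc.
Local Notation mu := (@lebesgue_measure R).

Lemma cvg_cLnorm2 (F : nat -> R -> R[i]) :
  cLnorm 2 (F n) @[n --> \oo] --> 0%E <-> sqn (F n) @[n --> \oo] --> 0%E.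
Proof.
have c0 n : (0 <= cLnorm 2 (F n))%E by rewrite cLnorm2E poweR_ge0.
have s0 n := sqn_ge0 (F n).
have pw (x : \bar R) (r : R) : (0 <= x)%E -> 0 <= r ->
   ((x `^ 2^-1)%E <= r%:E)%E = (x <= (r ^+ 2)%:E)%E.
  case: x => [x| |] //; rewrite ?lee_fin.
  - move=> x0 r0; rewrite powR12_sqrt//.
    by rewrite -{1}(ger0_norm r0) -sqrtr_sqr ler_sqrt ?sqr_ge0.
  - by move=> _ r0; rewrite poweRyr ?invr_eq0// !leNgt !ltry.
split; move=> /ecvg0P h; apply/ecvg0P => // e e0.
- have se0 : 0 < Num.sqrt e by rewrite sqrtr_gt0.
  apply: filterS (h c0 _ se0) => n.
  by rewrite cLnorm2E pw ?sqn_ge0 ?(ltW se0)// sqr_sqrtr// ltW.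
- have e20 : 0 < e ^+ 2 by rewrite exprn_gt0.
  by apply: filterS (h s0 _ e20) => n; rewrite cLnorm2E pw// ltW.
Qed.

End Plancherel.

(** * Almost everywhere convergence of fast Cauchy sequences *)

Section RieszFischer.
Context {R : realType}.
Import Normc.
Local Notation mu := (@lebesgue_measure R).

Lemma cvgn_geometric_increments (u : nat -> R) (C : R) :
  (forall k, `|u k.+1 - u k| <= C * 2^-1 ^+ k) -> cvgn u.
Proof.
move=> uC.
have C0 : 0 <= C by have := le_trans (normr_ge0 _) (uC 0%N); rewrite expr0 mulr1.
have : cvgn (series (telescope u)).
  apply: (@normed_cvg R R^o); apply: (@series_le_cvg _ _ (geometric C 2^-1)).
  - by move=> n; exact: normr_ge0.
  - by move=> n; rewrite /geometric/= mulr_ge0// exprn_ge0// invr_ge0.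
  - by move=> n; exact: uC.
  - by apply: is_cvg_geometric_series; rewrite ger0_norm ?invr_ge0// invf_lt1// ltr1n.
move=> h; rewrite (_ : u = (fun n => u 0%N + series (telescope u) n)).
  by apply: is_cvgD => //; exact: is_cvg_cst.
by apply/funext => n; rewrite -eq_sum_telescope.
Qed.

Variable F : nat -> R -> R[i].
Hypothesis mF : forall n, cmeasurable (F n).
Hypothesis dF : forall k, (sqn (fun t => F k.+1 t - F k t)%R <= (4 * 8^-1 ^+ k)%:E)%E.

(** The weight 4^k splits the rate 8^(-k) of the squared distances: the integrals of [w k] are still
    summable, like 2^(-k), and where the sum S of the [w k] is finite the increments are at most
    sqrt(S) 2^(-k). *)
Let w k t : \bar R := ((4 ^+ k) * normc (F k.+1 t - F k t) ^+ 2)%:E.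

Let w_ge0 k t : (0 <= w k t)%E.
Proof. by rewrite lee_fin mulr_ge0 ?sqr_ge0 ?exprn_ge0. Qed.

Let mw k : measurable_fun setT (w k).
Proof.
apply/measurable_EFinP; apply: measurable_funM; first exact: measurable_cst.
by apply: measurable_funX; apply: measurable_normc; exact: cmeasurableB.
Qed.

(** The number 4 / 2^k in the form of the halving geometric series, whose sum is 8. *)
Let pow_id (k : nat) : 4 ^+ k * (4 * 8^-1 ^+ k) = 8 / (2 ^ (k + 1))%:R :> R.
Proof.
have p0 : (2 : R) ^+ k != 0 by rewrite expf_neq0.
rewrite natrX exprD expr1 exprVn.
have e4 : (4 : R) ^+ k = 2 ^+ k * 2 ^+ k by rewrite -exprMn; congr (_ ^+ _); ring.
have e8 : (8 : R) ^+ k = 2 ^+ k * 2 ^+ k * 2 ^+ k by rewrite -!exprMn; congr (_ ^+ _); ring.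
by rewrite e4 e8; field.
Qed.

Let int_w k : (\int[mu]_t w k t <= (8 / (2 ^ (k + 1))%:R)%:E)%E.
Proof.
rewrite /w; under eq_integral do rewrite EFinM.
rewrite ge0_integralZl//; last 2 first.
- by apply: measurable_sqn; exact: cmeasurableB.
- by move=> t _; rewrite lee_fin sqr_ge0.
by rewrite -pow_id EFinM; apply: lee_wpmul2l => //; exact: dF.
Qed.

Let int_sum : (\int[mu]_t \sum_(0 <= k <oo) w k t <= 8%:E)%E.
Proof.
rewrite integral_nneseries//.
apply: le_trans (lee_nneseries _ _) _; last first.
- have := @cvg_geometric_eseries_half R 8 0; rewrite expr0 divr1 => /cvg_lim <- //.
  exact: lexx.
- by move=> k _; exact: int_w.
- by move=> k _ _; exact: integral_ge0.
Qed.

Lemma ae_cvg_fast : exists2 G : R -> R[i]^o, cmeasurable G &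
  {ae mu, forall t, (F n t : R[i]^o) @[n --> \oo] --> G t}.
Proof.
have mS : measurable_fun setT (fun t => \sum_(0 <= k <oo) w k t)%E.
  by apply: ge0_emeasurable_sum => //.
have iS : mu.-integrable setT (fun t => \sum_(0 <= k <oo) w k t)%E.
  apply/integrableP; split => //; apply: (@le_lt_trans _ _ 8%:E); last exact: ltry.
  apply: le_trans int_sum; rewrite le_eqVlt; apply/orP; left; apply/eqP.
  by apply: eq_integral => t _; rewrite gee0_abs// nneseries_ge0.
(* Upper limits are measurable and defined everywhere; they are the limits wherever the sequence
   converges. *)
exists (fun t => fine (limn_esup (fun n => (cRe (F n t))%:E)) +i*
                 fine (limn_esup (fun n => (cIm (F n t))%:E))).
  split => /=; apply: measurableT_comp => //; apply: measurable_fun_limn_esup => n.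
  - by apply/measurable_EFinP; case: (mF n).
  - by apply/measurable_EFinP; case: (mF n).
have FF := ae_filter_ringOfSetsType mu.
apply: (@filterS _ _ FF _ _ _ (integrable_ae measurableT iS)) => t /(_ I) St.
set S := (\sum_(0 <= k <oo) w k t)%E in St.
have S0 : 0 <= fine S by rewrite fine_ge0// nneseries_ge0.
have dk k : normc (F k.+1 t - F k t) <= Num.sqrt (fine S) * 2^-1 ^+ k.
  have h : (w k t <= S)%E.
    apply: le_trans (@nneseries_lim_ge _ _ xpredT 0%N k.+1 (fun k _ _ => w_ge0 k t)).
    by rewrite big_mkord big_ord_recr/= leeDr// sume_ge0.
  rewrite -(fineK St) lee_fin in h.
  rewrite -ler_sqr ?nnegrE ?normc_ge0 ?mulr_ge0 ?sqrtr_ge0 ?exprn_ge0 ?invr_ge0//.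
  rewrite exprMn sqr_sqrtr// -exprM mulnC exprM exprVn exprVn -natrX ler_pdivlMr ?exprn_gt0//.
  by rewrite mulrC.
have cR : cvgn (fun n => cRe (F n t)).
  apply: (@cvgn_geometric_increments _ (Num.sqrt (fine S))) => k.
  by rewrite -ReB (le_trans (normc_geRe _)).
have cI : cvgn (fun n => cIm (F n t)).
  apply: (@cvgn_geometric_increments _ (Num.sqrt (fine S))) => k.
  by rewrite -ImB (le_trans (normc_geIm _)).
have lim_fine (u : nat -> R) : cvgn u ->
    u n @[n --> \oo] --> fine (limn_esup (fun n => (u n)%:E)).
  move=> cu; have ul : (u n)%:E @[n --> \oo] --> (limn u)%:E.
    by apply: cvg_EFin cu; exact: nearW.
  by rewrite (cvg_limn_einf_sup ul).2.
by apply/cvg_complexP; split => /=; exact: lim_fine.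
Qed.

End RieszFischer.

(** * Existence of the Fourier transform on L^2 *)

Section Existence.
Context {R : realType}.
Import Normc.
Local Notation mu := (@lebesgue_measure R).
Variable g : R -> R[i].
Hypothesis g2 : inL2 g.

Let mg : cmeasurable g. Proof. by case: g2. Qed.

(** Approximants close to g have transforms close to each other. This gives both the Cauchy property
    of one chosen sequence and the comparison of any other sequence with it. *)
Let sqn_fourier_le f1 f2 : inL1 f1 -> inL1 f2 -> inL2 f1 -> inL2 f2 ->
  (sqn (fun y => fourierL1 f1 y - fourierL1 f2 y)%R <=
   2%:E * sqn (fun t => f1 t - g t)%R + 2%:E * sqn (fun t => f2 t - g t)%R)%E.
Proof.
move=> /inL1P i1 /inL1P i2 l1 l2.
have m1 := cintegrable_meas i1; have m2 := cintegrable_meas i2.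
rewrite -(fourierL1B i1 i2) (sqnC f2).
apply: le_trans (sqnB m1 m2 mg); apply: sqn_fourierL1_le; last exact: inL2B.
have := cintegrableD i1 (cintegrableZ (-1) i2).
by congr cintegrable; apply/funext => t; rewrite mulN1r.
Qed.

Lemma ex_fourierL2 : exists ghat, is_fourierL2 g ghat.
Proof.
(* Two distances to g of square at most [r k] give a squared distance of at most [4 * r k] between
   transforms, the rate assumed in [ae_cvg_fast]. *)
pose r k : R := 8^-1 ^+ k.
have r0 k : 0 < r k by rewrite exprn_gt0// invr_gt0.
have rn k : exists n, (sqn (fun t => trunc g n t - g t)%R <= (r k)%:E)%E.
  have /ecvg0P h := cvg_sqn_trunc g2.
  have [n hn] := filter_ex (h (fun n => sqn_ge0 _) _ (r0 k)).
  by exists n.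
have [nk hnk] := choice rn.
pose G k := trunc g (nk k); pose Gh k := fourierL1 (G k).
have iG k : inL1 (G k) by exact: inL1_trunc.
have lG k : inL2 (G k) by exact: inL2_trunc.
have mGh k : cmeasurable (Gh k) by apply: cmeasurable_fourierL1; apply/inL1P.
have dG i j : (i <= j)%N -> (sqn (fun y => Gh i y - Gh j y)%R <= (4 * r i)%:E)%E.
  move=> ij; apply: le_trans (sqn_fourier_le (iG i) (iG j) (lG i) (lG j)) _.
  have hj : (sqn (fun t => G j t - g t)%R <= (r i)%:E)%E.
    apply: le_trans (hnk j) _; rewrite lee_fin /r.
    by rewrite ler_wiXn2l// ?invr_ge0// invf_le1// ler1n.
  rewrite (_ : (4 * r i)%:E = (2%:E * (r i)%:E + 2%:E * (r i)%:E)%E); last first.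
    by rewrite -EFinM -EFinD; congr (_%:E); ring.
  by apply: leeD; apply: lee_wpmul2l => //; exact: hnk.
have [|ghat mghat ghatP] := @ae_cvg_fast _ Gh mGh.
  by move=> k; rewrite sqnC; exact: dG.
(* The Cauchy estimate between the indices k and k + j, with j tending to infinity. *)
have Gh_ghat k : (sqn (fun y => Gh k y - ghat y)%R <= (4 * r k)%:E)%E.
  apply: (@sqn_fatou _ (fun j y => Gh k y - Gh (k + j)%N y)).
  - by move=> j; exact: cmeasurableB.
  - exact: cmeasurableB.
  - have FF := ae_filter_ringOfSetsType mu.
    apply: (@filterS _ _ FF _ _ _ ghatP) => y hy.
    have hy' : (Gh (k + j)%N y : R[i]^o) @[j --> \oo] --> ghat y.
      under eq_fun do rewrite addnC.
      by move: hy; rewrite -(cvg_shiftn k).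
    exact: (cvgB (cvg_cst (Gh k y : R[i]^o)) hy').
  - by move=> j; apply: dG; rewrite leq_addr.
have Gh2 k : inL2 (Gh k).
  apply/inL2P; split => //.
  apply: le_lt_trans (sqn_fourierL1_le _ (lG k)) _; first exact/inL1P.
  by case/inL2P : (lG k).
exists ghat; split.
  rewrite (_ : ghat = (fun y => Gh 0%N y - (Gh 0%N y - ghat y))).
    apply: inL2B => //; apply/inL2P; split; first exact: cmeasurableB.
    by apply: le_lt_trans (Gh_ghat 0%N) _; exact: ltry.
  by apply/funext => y; rewrite opprB addrC subrK.
move=> f_ f12 /cvg_cLnorm2 /ecvg0P fg; apply/cvg_cLnorm2.
apply/ecvg0P => [n|e e0]; first exact: sqn_ge0.
(* The final bound is 2 (2 e/8 + 2 r) + 2 (4 r) = e/2 + 12 r, with r = [r k]. *)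
have [k hk] : exists k, 12 * r k <= e / 2.
  have : r k @[k --> \oo] --> 0.
    by apply: cvg_expr; rewrite ger0_norm ?invr_ge0// invf_lt1// ltr1n.
  move=> /cvgrPdist_le /(_ (e / 24)) []; first by rewrite divr_gt0.
  move=> k _ /(_ k (leqnn k)); rewrite sub0r normrN ger0_norm ?(ltW (r0 k))// => h.
  by exists k; lra.
have e8 : 0 < e / 8 by rewrite divr_gt0.
apply: filterS (fg (fun n => sqn_ge0 _) _ e8) => n hn.
have [i1 l1] := f12 n.
have m1 : cmeasurable (fourierL1 (f_ n)) by apply: cmeasurable_fourierL1; apply/inL1P.
apply: le_trans (sqnB m1 mghat (mGh k)) _.
have h1 := sqn_fourier_le i1 (iG k) l1 (lG k).
apply: (@le_trans _ _ (2%:E * (2%:E * (e / 8)%:E + 2%:E * (r k)%:E) + 2%:E * (4 * r k)%:E)%E).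
  apply: leeD; apply: lee_wpmul2l => //.
  apply: le_trans h1 _; apply: leeD; apply: lee_wpmul2l => //; exact: hnk.
rewrite -!(EFinM, EFinD) lee_fin; lra.
Qed.

Lemma fourierL2P : is_fourierL2 g (fourierL2 g).
Proof. by apply: xgetPex; exact: ex_fourierL2. Qed.

End Existence.

(** * The weak limit *)

Section WeakLimit.
Context {R : realType}.
Import Normc.
Variables (lambda eps : R) (h g : R -> R[i]).
Hypotheses (hC : Cc h) (g2 : inL2 g).
Local Notation wavesum := (wavesum lambda eps h).

Lemma cvg_inner_wavesum_inL2 (N : nat -> R) :
  (forall n, 1 <= N n) -> N n @[n --> \oo] --> +oo ->
  (inner g (wavesum (N n)) : R[i]^o) @[n --> \oo] --> (inner (fourierL2 g) h : R[i]^o).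
Proof.
move=> N1 Noo; have [gh2 ghP] := fourierL2P g2; set gh := fourierL2 g in gh2 ghP *.
have h2 := Cc_inL2 hC.
have t1 n := inL1_trunc g2 n; have t2 n := inL2_trunc g2 n.
have ct := cvg_sqn_trunc g2.
have /cvg_cLnorm2 cth := ghP _ (fun n => conj (t1 n) (t2 n)) ((cvg_cLnorm2 _).2 ct).
have K2 n : inL2 (wavesum (N n)) by apply: inL2_wavesum => //; exact: lt_le_trans (N1 n).
(* Since |S_N|^2 tends to |h|^2, this bounds both |h|^2 and, eventually, |S_N|^2. *)
pose B := fine (sqn h) + 1.
have B0 : 0 < B by rewrite ltr_wpDl// fine_ge0// sqn_ge0.
have BK : \forall n \near \oo, fine (sqn (wavesum (N n))) <= B.
  have /cvgrPdist_le /(_ 1 ltr01) := cvg_sqn_wavesum lambda eps hC N1 Noo.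
  by apply: filterS => n; rewrite ler_distlC => /andP[_].
apply/cvg_normcP/cvgrPdist_le => e e0.
(* With this weight the bounded factors S_N and h contribute at most B/c = e/8. The truncation is
   then chosen so that c times its squared distance to g is also at most e/8, and likewise for its
   transform. *)
pose c := 8 * B / e.
have c0 : 0 < c by rewrite divr_gt0// mulr_gt0.
have cB : c^-1 * B = e / 8 by rewrite /c; field; rewrite !gt_eqF.
have d0 : 0 < e / 8 / c by apply: divr_gt0 => //; apply: divr_gt0.
have n1 := (ecvg0P (fun n => sqn_ge0 _)).1 ct _ d0.
have n2 := (ecvg0P (fun n => sqn_ge0 _)).1 cth _ d0.
have [k [hk hhk]] := filter_ex (filterI n1 n2).
pose gk := trunc g k; pose ghk := fourierL1 gk.
have gk2 : inL2 gk by exact: t2.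
have igk : cintegrable gk by apply/inL1P; exact: t1.
have ghk2 : inL2 ghk.
  apply/inL2P; split; first exact: cmeasurable_fourierL1.
  by apply: le_lt_trans (sqn_fourierL1_le igk gk2) _; case/inL2P : gk2.
have e4 : 0 < e / 4 by rewrite divr_gt0.
have /cvg_normcP /cvgrPdist_le /(_ _ e4) n3 := cvg_inner_wavesum lambda eps hC N1 Noo igk.
have small f : inL2 f -> (sqn f <= (e / 8 / c)%:E)%E -> c * fine (sqn f) <= e / 8.
  by move=> f2 hf; rewrite mulrC -ler_pdivlMr// -lee_fin fineK// inL2_fin.
apply: filterS2 BK n3 => n hB; rewrite !sub0r !normrN !(ger0_norm (normc_ge0 _)) => hn.
(* Each of the three terms will be at most e/4: the outer ones by approximation, the middle one by
   the limit for integrable functions. *)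
have -> : inner g (wavesum (N n)) - inner gh h = inner (fun t => g t - gk t) (wavesum (N n)) +
    ((inner gk (wavesum (N n)) - inner ghk h) + inner (fun t => ghk t - gh t) h).
  rewrite !innerBl//; ring.
have l1 : normc (inner (fun t => g t - gk t) (wavesum (N n))) <= e / 8 + e / 8.
  apply: le_trans (normc_inner_le c0 (inL2B g2 gk2) (K2 n)) _.
  rewrite lerD//; first by apply: small; [exact: inL2B|rewrite sqnC].
  by rewrite -cB ler_wpM2l// invr_ge0 ltW.
have l2 : normc (inner (fun t => ghk t - gh t) h) <= e / 8 + e / 8.
  apply: le_trans (normc_inner_le c0 (inL2B ghk2 gh2) h2) _.
  rewrite lerD//; first by apply: small => //; exact: inL2B.
  by rewrite -cB ler_wpM2l ?invr_ge0 ?(ltW c0)// lerDl.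
apply: le_trans (le_normcD _ _) _.
have := le_normcD (inner gk (wavesum (N n)) - inner ghk h) (inner (fun t => ghk t - gh t) h).
lra.
Qed.

End WeakLimit.

Theorem corollary1p5 (R : realType) (h : R -> R[i]) (lambda epsilon : R)
    (h_cont : continuous (h : R -> R[i]^o))
    (h_supp : compact (closure [set y : R | h y != 0]))
    (g : R -> R[i]) (g_L2 : inL2 g) :
  ((inner (dilation lambda x g) (h_ lambda epsilon h x) : R[i]^o)
     @[x --> +oo] --> (inner (fourierL2 g) h : R[i]^o)).
Proof.
have hC := Cc_of_compact h_cont h_supp.
(* Dominated convergence concerns sequences, so the limit in x is tested along every sequence
   tending to infinity. *)
have seq_cvg (u : nat -> R) : u n @[n --> \oo] --> +oo ->
    (inner (dilation lambda (u n) g) (h_ lambda epsilon h (u n)) : R[i]^o) @[n --> \oo] -->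
    (inner (fourierL2 g) h : R[i]^o).
  (* The first terms of the sequence may lie below 1, or even be negative; replacing them by 1
     leaves the limit unchanged and gives x^2 >= 1 for all n. *)
  move=> /cvgryPge uooA; pose x n := Num.max 1 (u n).
  have x1 n : 1 <= x n by rewrite le_max lexx.
  have x0 n : 0 < x n by exact: lt_le_trans (x1 n).
  have ux : \forall n \near \oo, x n = u n.
    by apply: filterS (uooA 1) => n u1; rewrite /x max_r.
  have N1 n : 1 <= x n ^+ 2 by rewrite exprn_ege1.
  have Noo : x n ^+ 2 @[n --> \oo] --> +oo.
    apply/cvgryPge => A; apply: filterS (uooA A) => n uA.
    rewrite expr2 (le_trans uA)// (@le_trans _ _ (x n)) ?ler_peMl ?(ltW (x0 n))//.
    by rewrite le_max lexx orbT.
  have := cvg_inner_wavesum_inL2 lambda epsilon hC g_L2 N1 Noo; apply: cvg_trans.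
  apply: near_eq_cvg; apply: filterS ux => n <-.
  by rewrite inner_dilation_h//; apply: inL2_wavesum => //; rewrite exprn_gt0.
apply/cvg_complexP; split.
- by apply/cvg_pinftyP => u /seq_cvg /cvg_complexP[].
- by apply/cvg_pinftyP => u /seq_cvg /cvg_complexP[].
Qed.
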